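(* Let $m\geq 2$ and $N\in\{0,1,2,\ldots\}$, and let $\lambda=(N+1,\ldots,N+1,N,\ldots,N)\in\mathbb{N}^m$ with any number of entries equal to $N$ (possibly all $m$ of them). Then for any collection of pairwise distinct complex numbers $z=(z_1,\ldots,z_{|\lambda|})$, the space of conformal blocks $CB^1_z(\lambda)$ is one-dimensional and the polynomial $P_z(\lambda)$ is a basis of it.
   Context: $\mathbb{N}=\{0,1,2,\ldots\}$. For a partition $\lambda=(\lambda_1\geq\cdots\geq\lambda_m)\in\mathbb{N}^m$, $m\ge 2$, write $|\lambda|=\sum_i\lambda_i$ and $d(\lambda)=\lambda_1-\lambda_m$. Let $V^{\otimes|\lambda|}$ denote the space of polynomials in the variables $y^{(j)}_a$ ($1\le j\le m$, $1\le a\le|\lambda|$), with complex coefficients, that are homogeneous of degree 1 in the $m$-tuple $y^{(1)}_a,\ldots,y^{(m)}_a$ for each $a$ (this is the tensor power of the vector representation $V$ of $\mathfrak{gl}_m$). Let $z=(z_1,\ldots,z_{|\lambda|})$ be pairwise distinct complex numbers. Put $$e_{i,j}=\sum_{a=1}^{|\lambda|}y^{(i)}_a\frac{\partial}{\partial y^{(j)}_a},\qquad e^{z}_{i,j}=\sum_{a=1}^{|\lambda|}z_a\,y^{(i)}_a\frac{\partial}{\partial y^{(j)}_a}.$$ The space of singular vectors of weight $\lambda$ is $SV(\lambda)=\{p\in V^{\otimes|\lambda|} : e_{i,j}p=0 \text{ for } 1\le i<j\le m,\ e_{i,i}p=\lambda_i p \text{ for } 1\le i\le m\}$. For a positive integer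 $\ell\geq d(\lambda)$ the space of conformal blocks at level $\ell$ is $$CB^\ell_z(\lambda)=\{p\in SV(\lambda) : (e^z_{1,m})^{\ell-d(\lambda)+1}p=0\}.$$ For finite index sets $I,J$, let $R(z_I|z_J)=\prod_{a\in I}\prod_{b\in J}(z_a-z_b)$ and $R(z_{I_1}|\ldots|z_{I_m})=\prod_{i<j}R(z_{I_i}|z_{I_j})$. For $U\subset\{1,\ldots,|\lambda|\}$ put $Y^{(j)}_U=\prod_{a\in U}y^{(j)}_a$. Define $$P_z(\lambda)=\sum_{(I_1,\ldots,I_m)}\frac{\prod_{j=1}^m Y^{(j)}_{I_j}}{R(z_{I_1}|z_{I_2}|\ldots|z_{I_m})},$$ where the sum runs over all ordered tuples $(I_1,\ldots,I_m)$ of pairwise disjoint sets with $\bigcup_j I_j=\{1,\ldots,|\lambda|\}$ and $|I_j|=\lambda_j$. *)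

(* Defs.v *)
From HB Require Import structures.
From mathcomp Require Import all_boot all_order all_algebra.
From mathcomp Require Import mpoly.
From mathcomp Require Import complex.

Set Implicit Arguments.
Unset Strict Implicit.
Unset Printing Implicit Defensive.

Import GRing.Theory.
Local Open Scope ring_scope.

(* Linear algebra in a subspace of a possibly infinite-dimensional module,
   such as a space of polynomials, where [vspace] is not available. *)
Section Bases.
Variables (F : fieldType) (W : lmodType F).

Definition is_basis (S : {pred W}) (k : nat) (b : k.-tuple W) : Prop :=
  [/\ forall i, tnth b i \in S,
      forall c : 'I_k -> F,
        \sum_(i < k) c i *: tnth b i = 0 -> forall i, c i = 0
    & forall w, w \in S ->
        exists c : 'I_k -> F, w = \sum_(i < k) c i *: tnth b i].

Definition has_dim (S : {pred W}) (k : nat) : Prop :=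
  exists b : k.-tuple W, is_basis S b.

End Bases.

Section Partitions.
Variable m : nat.

(* Indices are shifted by one: the entries [lambda_1, ..., lambda_(m+1)] are
   [lambda ord0, ..., lambda ord_max]. *)
Definition psize (lambda : 'I_m.+1 -> nat) : nat := (\sum_(i < m.+1) lambda i)%N.

Definition pdiff (lambda : 'I_m.+1 -> nat) : nat :=
  (lambda ord0 - lambda ord_max)%N.

End Partitions.

Section Operators.
Variables (F : fieldType) (m n : nat).

(* The variables y^(j)_a are numbered by the bijection [mxvec_index] from
   pairs (j, a) to ['I_(m * n)]. *)
Definition yvar (j : 'I_m) (a : 'I_n) : {mpoly F[m * n]} :=
  'X_(mxvec_index j a).

Definition dy (j : 'I_m) (a : 'I_n) (p : {mpoly F[m * n]}) :
    {mpoly F[m * n]} :=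
  p^`M(mxvec_index j a).

(* V^{(x) n}: every monomial of p has degree 1 in the variables
   y^(1)_a, ..., y^(m)_a, for each a. *)
Definition tensV : {pred {mpoly F[m * n]}} :=
  [pred p : {mpoly F[m * n]} | all (fun mu : 'X_{1.. m * n} =>
     [forall a : 'I_n, \sum_(j < m) mu (mxvec_index j a) == 1]%N) (msupp p)].

Definition e_op (i j : 'I_m) (p : {mpoly F[m * n]}) : {mpoly F[m * n]} :=
  \sum_(a < n) yvar i a * dy j a p.

Definition ez_op (z : 'I_n -> F) (i j : 'I_m) (p : {mpoly F[m * n]}) :
    {mpoly F[m * n]} :=
  \sum_(a < n) z a *: (yvar i a * dy j a p).

Definition Yprod (j : 'I_m) (U : {set 'I_n}) : {mpoly F[m * n]} :=
  \prod_(a in U) yvar j a.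

Definition R2 (z : 'I_n -> F) (I J : {set 'I_n}) : F :=
  \prod_(a in I) \prod_(b in J) (z a - z b).

Definition Rmulti (z : 'I_n -> F) (I : {ffun 'I_m -> {set 'I_n}}) : F :=
  \prod_(i < m) \prod_(j < m | (i < j)%N) R2 z (I i) (I j).

Definition ordered_partition (lambda : 'I_m -> nat)
    (I : {ffun 'I_m -> {set 'I_n}}) : bool :=
  [&& [forall i, forall j, (i != j) ==> [disjoint I i & I j]],
      \bigcup_(j < m) I j == [set: 'I_n]
    & [forall j, #|I j| == lambda j]].

End Operators.
Arguments tensV : clear implicits.
Arguments Yprod F {m n} j U.
Arguments ordered_partition {m n} lambda I.

Section ConformalBlocks.
Variables (F : fieldType) (m : nat) (lambda : 'I_m.+1 -> nat).
Local Notation n := (psize lambda).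

Definition SV : {pred {mpoly F[m.+1 * n]}} :=
  [pred p | [&& p \in tensV F m.+1 n,
      [forall i : 'I_m.+1, forall j : 'I_m.+1,
         (i < j)%N ==> (e_op i j p == 0)]
    & [forall i : 'I_m.+1, e_op i i p == (lambda i)%:R *: p]]].

(* Conformal blocks at level l; meant for l >= pdiff lambda, so that the
   truncated subtraction is the true one. *)
Definition CB (l : nat) (z : 'I_n -> F) : {pred {mpoly F[m.+1 * n]}} :=
  [pred p | (p \in SV) &&
     (iter (l - pdiff lambda).+1 (ez_op z ord0 ord_max) p == 0)].

Definition Ppoly (z : 'I_n -> F) : {mpoly F[m.+1 * n]} :=
  \sum_(I : {ffun 'I_m.+1 -> {set 'I_n}} | ordered_partition lambda I)
     (Rmulti z I)^-1 *: \prod_(j < m.+1) Yprod F j (I j).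

End ConformalBlocks.
Arguments SV F {m} lambda.
Arguments CB {F m} lambda l z.
Arguments Ppoly {F m} lambda z.

Section Subspaces.
Variables (F : fieldType).

Lemma tensV_submod (m n : nat) : submod_closed (tensV F m n).
Proof.
split=> [|c p q]; first by rewrite inE msupp0.
rewrite !inE => /allP hp /allP hq; apply/allP => mu /msuppD_le.
rewrite mem_cat => /orP[/msuppZ_le|]; [exact: hp | exact: hq].
Qed.

Lemma e_op_linear (m n : nat) (i j : 'I_m) c (p q : {mpoly F[m * n]}) :
  e_op i j (c *: p + q) = c *: e_op i j p + e_op i j q.
Proof.
rewrite /e_op scaler_sumr -big_split /=; apply: eq_bigr => a _.
by rewrite /dy mderivD mderivZ mulrDr scalerAr.
Qed.

Lemma ez_op_linear (m n : nat) z (i j : 'I_m) c (p q : {mpoly F[m * n]}) :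
  ez_op z i j (c *: p + q) = c *: ez_op z i j p + ez_op z i j q.
Proof.
rewrite /ez_op scaler_sumr -big_split /=; apply: eq_bigr => a _.
by rewrite /dy mderivD mderivZ mulrDr scalerDr -scalerAr !scalerA mulrC.
Qed.

Lemma SV_submod (m : nat) (lambda : 'I_m.+1 -> nat) :
  submod_closed (SV F lambda).
Proof.
have [t0 tD] := tensV_submod m.+1 (psize lambda).
have e0 i j : e_op i j (0 : {mpoly F[m.+1 * psize lambda]}) = 0.
  by rewrite /e_op big1 // => a _; rewrite /dy mderiv0 mulr0.
split=> [|c p q].
  rewrite inE t0 /=; apply/andP; split.
    by apply/forallP=> i; apply/forallP=> j; rewrite e0 eqxx implybT.
  by apply/forallP=> i; rewrite e0 scaler0.
rewrite inE => /and3P[pt /forallP pn /forallP pd].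
rewrite inE => /and3P[qt /forallP qn /forallP qd].
rewrite inE tD //=; apply/andP; split.
  apply/forallP=> i; apply/forallP=> j; apply/implyP=> ij.
  have /implyP/(_ ij)/eqP hp := forallP (pn i) j.
  have /implyP/(_ ij)/eqP hq := forallP (qn i) j.
  by rewrite e_op_linear hp hq scaler0 addr0.
apply/forallP=> i; rewrite e_op_linear (eqP (pd i)) (eqP (qd i)).
by rewrite scalerDr !scalerA mulrC.
Qed.

Lemma CB_submod (m : nat) (lambda : 'I_m.+1 -> nat) l z :
  submod_closed (CB (F := F) lambda l z).
Proof.
have [s0 sD] := SV_submod lambda.
pose E := @ez_op F m.+1 (psize lambda) z ord0 ord_max.
have ED k c p q : iter k E (c *: p + q) = c *: iter k E p + iter k E q.
  by elim: k => //= k ->; rewrite /E ez_op_linear.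
split=> [|c p q].
  rewrite inE s0 -/E /=; have := ED (l - pdiff lambda).+1 (-1) 0 0.
  by rewrite scaler0 addr0 scaleN1r addNr iterS => ->; apply: eqxx.
rewrite inE => /andP[ps /eqP pE]; rewrite inE => /andP[qs /eqP qE].
by rewrite inE sD //= -/E -iterS ED pE qE scaler0 addr0.
Qed.

End Subspaces.

(* Main.v *)
Require Import Defs.
From HB Require Import structures.
From mathcomp Require Import all_boot all_order all_algebra.
From mathcomp Require Import mpoly complex reals.
From mathcomp Require Import ring zify.

(** A polynomial of the tensor power is a function [c] on words [w : T -> C]
  ([T] the positions, [C] the colours), and [sum_a u_a y^(i)_a d/dy^(j)_a]
  becomes an operator [Eop i j u].  These operators satisfy the relations of
  gl_m tensored with the functions on the points.  The coefficient function of
  [P_z] is the inverse of the product of the differences [z_s - z_t] over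
  [w s < w t]; the conformal block equations for it are vanishing divided
  differences.

  Uniqueness: commutators with lowering operators propagate the level-one
  condition from the colours (1, m) to every pair of colours [i < j].  For
  such a pair it suffices to see that exchanging the colours [i] and [j] at
  two positions changes [c] in the same way as it changes the coefficients of
  [P_z].  This is an sl_2 statement about weights 0 and 1, proved by induction
  on the number of positions of colour [j]: fixing the colour of one point [s]
  and multiplying by the factor predicted for [s] turns a weight 1 block into a
  weight 0 block on the other points, and conversely.  Both steps rest on sl_2
  representation theory, for twisted triples such as
  ([E_ji(x)], [E_ij(1/x)]) with [x = z - z_s]. *)

Set Implicit Arguments.
Unset Strict Implicit.
Unset Printing Implicit Defensive.

Import GRing.Theory Num.Theory.
Local Open Scope ring_scope.

(** * Commutation relations of abstract additive operators *)

Section AbstractOperators.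
Variable V : zmodType.
Hypothesis torsion_free : forall (v : V) n, v *+ n.+1 = 0 -> v = 0.

(** Applying [X] to [Y (Y c) = 0] gives [2 Y (G c) = 0], and applying it once more gives
    [G (G c) = 0]. *)
Lemma central_commutator_sq (X Y G : {additive V -> V}) (c : V) :
    (forall v, X (Y v) = Y (X v) + G v) ->
    (forall v, X (G v) = G (X v)) -> (forall v, Y (G v) = G (Y v)) ->
  X c = 0 -> Y (Y c) = 0 -> G (G c) = 0.
Proof.
move=> XY XG YG Xc YYc; apply: (@torsion_free _ 1).
have XYc : X (Y c) = G c by rewrite XY Xc raddf0 add0r.
have := congr1 X YYc; rewrite XY XYc YG raddf0 -mulr2n => /(@torsion_free _ 1) GYc.
by have := congr1 X GYc; rewrite XG XYc raddf0 => ->; rewrite mul0rn.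
Qed.

(* [(ad X)^4 (F^2) = 24 K^2], since [(ad X)^2 F = - 2 K] and [(ad X)^3 F = 0]. *)
Lemma ad_double_commutator_sq (X F H K : {additive V -> V}) (c : V) :
    (forall v, X (F v) = F (X v) + H v) ->
    (forall v, X (H v) = H (X v) - K v *+ 2) ->
    (forall v, X (K v) = K (X v)) ->
  X c = 0 -> F (F c) = 0 -> K (K c) = 0.
Proof.
move=> XF XH XK Xc FFc; apply: (@torsion_free _ 23).
have XFc : X (F c) = H c by rewrite XF Xc raddf0 add0r.
have XHc : X (H c) = - (K c *+ 2) by rewrite XH Xc raddf0 add0r.
have XKc : X (K c) = 0 by rewrite XK Xc raddf0.
(* [X] is applied four times in a row, starting from [F (F c) = 0]. The last three applications
   produce the factors 2, 3 and 4; [torsion_free] with argument [n] cancels [n + 1]. *)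
have X1 : F (H c) + H (F c) = 0 by rewrite -XFc -XF FFc raddf0.
have X2 : H (H c) = K (F c) + F (K c).
  apply/eqP; rewrite -subr_eq0; apply/eqP/(@torsion_free _ 1).
  have := congr1 X X1; rewrite raddfD raddf0 XF (XH (F c)) XHc XFc raddfN raddfMn => <-.
  rewrite [_ + H (H c)]addrC addrACA [_ - K (F c) *+ 2]addrC.
  by rewrite mulrnBl mulrnDl opprD mulr2n.
have X3 : K (H c) + H (K c) = 0.
  apply: (@torsion_free _ 2).
  have := congr1 X X2; rewrite !raddfD /= (XH (H c)) (XF (K c)) (XK (F c)).
  rewrite XHc XFc XKc !raddf0 add0r raddfN raddfMn -opprD -mulrnDl addrC.
  by move=> /eqP; rewrite eq_sym -addr_eq0 -mulrS => /eqP.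
have := congr1 X X3; rewrite raddfD raddf0 XK (XH (K c)) XKc XHc raddf0 add0r.
rewrite raddfN raddfMn -opprD -mulrnDr => /eqP; rewrite oppr_eq0 => /eqP/(@torsion_free _ 3) ->.
by rewrite mul0rn.
Qed.

(** * Consequences of the sl_2 relations for a nilpotent lowering operator *)

Section SL2.
Variables X Y H : {additive V -> V}.
Hypothesis XY : forall v, X (Y v) = Y (X v) + H v.
Hypothesis HY : forall v, H (Y v) = Y (H v) - Y v *+ 2.
Hypothesis XH : forall v, X (H v) = H (X v) - X v *+ 2.
Variable n : nat.
Hypothesis Ynilp : forall v, iter n Y v = 0.

(** On the lowering string, [X Y^(k+1) v = -(k+1)(d+1+k) Y^k v] with a nonzero coefficient, so
    vanishing descends from a high power of [Y] to [v] itself. Nilpotency of [Y] stands in for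
    finite dimension. *)
Lemma sl2_negative_singular d v : X v = 0 -> H v = - (v *+ d.+1) -> v = 0.
Proof.
move=> Xv Hv.
have HYk k : H (iter k Y v) = - (iter k Y v *+ (d.+1 + k.*2)).
  elim: k => [|k IH]; first by rewrite addn0.
  by rewrite iterS HY IH raddfN raddfMn -opprD -mulrnDr doubleS !addnS addn0.
have XYk k : X (iter k.+1 Y v) = - (iter k Y v *+ (k.+1 * (d.+1 + k))).
  elim: k => [|k IH]; first by rewrite /= XY Xv raddf0 add0r Hv mul1n addn0.
  rewrite iterS XY IH HYk raddfN raddfMn -opprD -mulrnDr.
  by congr (- (_ *+ _)); lia.
have down k : iter k Y v = 0 -> v = 0.
  elim: k => // k IH Yk; apply: IH; apply: (@torsion_free _ (k.+1 * (d.+1 + k)).-1).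
  apply/eqP; rewrite prednK ?muln_gt0 // -oppr_eq0 -XYk Yk raddf0 //.
exact: down (Ynilp v).
Qed.

(** [Y v] is singular of weight -2. *)
Lemma sl2_weight0 v : X v = 0 -> H v = 0 -> Y v = 0.
Proof.
move=> Xv Hv; apply: (@sl2_negative_singular 1).
  by rewrite XY Xv Hv raddf0 add0r.
by rewrite HY Hv raddf0 add0r.
Qed.

(** [Y (Y v)] is singular of weight -3. *)
Lemma sl2_weight1 v : X v = 0 -> H v = v -> Y (Y v) = 0.
Proof.
move=> Xv Hv.
have HYv : H (Y v) = - Y v by rewrite HY Hv mulr2n opprD addrA subrr add0r.
apply: (@sl2_negative_singular 2).
  by rewrite XY XY Xv Hv HYv raddf0 add0r subrr.
by rewrite HY HYv raddfN -opprD -mulrS.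
Qed.

(** [Y (X v) - v] is singular of weight -1, hence zero; this makes [Y v] singular, of weight -3. *)
Lemma sl2_weightN1 v : X (X v) = 0 -> H v = - v -> Y v = 0.
Proof.
move=> XXv Hv.
have HXv : H (X v) = X v.
  have /eqP := XH v; rewrite Hv raddfN eq_sym subr_eq => /eqP ->.
  by rewrite mulr2n addrA addNr add0r.
have YvE : Y (X v) - v = 0.
  apply: (@sl2_negative_singular 0).
    by rewrite raddfB XY XXv HXv raddf0 add0r subrr.
  by rewrite raddfB HY HXv Hv mulr2n opprD addrA subrr add0r opprB addrC opprK.
apply: (@sl2_negative_singular 2).
  by rewrite XY Hv.
by rewrite HY Hv raddfN -opprD -mulrS.
Qed.

End SL2.
End AbstractOperators.

(** * Operators on functions of words *)

Section WordOperators.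
Variables (F : numFieldType) (T C : finType).
Local Notation word := {ffun T -> C}.
Local Notation wfun := {ffun word -> F}.

Lemma wfun_torsion_free (c : wfun) n : c *+ n.+1 = 0 -> c = 0.
Proof.
move=> cn0; apply/ffunP=> w; rewrite ffunE; apply/eqP.
have /eqP := congr1 (fun c : wfun => c w) cn0.
by rewrite ffunMnE ffunE mulrn_eq0.
Qed.

Definition upd (w : word) (a : T) (j : C) : word :=
  [ffun b => if b == a then j else w b].

Lemma updE w a j b : upd w a j b = if b == a then j else w b.
Proof. by rewrite ffunE. Qed.

Lemma upd_same w a j : upd w a j a = j.
Proof. by rewrite updE eqxx. Qed.

Lemma upd_neq w a j b : b != a -> upd w a j b = w b.
Proof. by rewrite updE => /negPf ->. Qed.

Lemma upd_id w a : upd w a (w a) = w.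
Proof. by apply/ffunP=> b; rewrite updE; case: eqP => // ->. Qed.

Lemma upd_upd w a j k : upd (upd w a j) a k = upd w a k.
Proof. by apply/ffunP=> b; rewrite !updE; case: eqP. Qed.

Lemma updC w a b j k : a != b -> upd (upd w a j) b k = upd (upd w b k) a j.
Proof.
move=> ab; apply/ffunP=> s; rewrite !updE.
by case: (eqVneq s b) => // ->; rewrite eq_sym (negPf ab).
Qed.

(* The coefficient function of [\sum_a u_a y^(i)_a d/dy^(j)_a p], where [c w]
   is the coefficient of the monomial [\prod_a y^(w a)_a] in [p]. *)
Definition Eop (i j : C) (u : T -> F) (c : wfun) : wfun :=
  [ffun w : word => \sum_(a | w a == i) u a * c (upd w a j)].

Lemma EopE i j u (c : wfun) w :
  Eop i j u c w = \sum_(a | w a == i) u a * c (upd w a j).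
Proof. by rewrite ffunE. Qed.

Fact Eop_is_additive i j u : zmod_morphism (Eop i j u).
Proof.
move=> c d; apply/ffunP=> w; rewrite !ffunE -sumrB; apply: eq_bigr => a _.
by rewrite !ffunE mulrBr.
Qed.

HB.instance Definition _ i j u :=
  GRing.isZmodMorphism.Build wfun wfun (Eop i j u) (Eop_is_additive i j u).

Lemma eq_Eop i j u v : u =1 v -> Eop i j u =1 Eop i j v.
Proof. by move=> uv c; apply/ffunP=> w; rewrite !EopE; apply: eq_bigr => a _; rewrite uv. Qed.

Lemma EopD i j u v c :
  Eop i j (fun a => u a + v a) c = Eop i j u c + Eop i j v c.
Proof.
apply/ffunP=> w; rewrite !ffunE -big_split /=; apply: eq_bigr => a _.
by rewrite mulrDl.
Qed.

Lemma EopZ i j r u c w :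
  Eop i j (fun a => r * u a) c w = r * Eop i j u c w.
Proof. by rewrite !EopE mulr_sumr; apply: eq_bigr => a _; rewrite mulrA. Qed.

Lemma EopZ_eq0 i j r u c : Eop i j u c = 0 -> Eop i j (fun a => r * u a) c = 0.
Proof. by move=> uc; apply/ffunP=> w; rewrite EopZ uc !ffunE mulr0. Qed.

Lemma Eop_diag i u c w : Eop i i u c w = (\sum_(a | w a == i) u a) * c w.
Proof.
rewrite EopE mulr_suml; apply: eq_bigr => a /eqP wa.
by rewrite -wa upd_id.
Qed.

(** Terms acting at two distinct positions are separated from those acting twice at one position.
    The former agree for both orders of composition, so only the latter survive in a commutator. *)
Lemma Eop_comp i j k l u v c w :
  Eop i j u (Eop k l v c) w =
    \sum_a \sum_(b | b != a) ((w a == i) && (w b == k))%:R *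
        (u a * v b * c (upd (upd w a j) b l))
    + (Eop i l (fun a => u a * v a) c) w *+ (j == k).
Proof.
rewrite !EopE -sumrMnl big_mkcond [X in _ + X]big_mkcond -big_split /=.
apply: eq_bigr => a _; case: eqP => wa /=; last first.
  by rewrite big1 ?addr0 // => b _; rewrite mul0r.
rewrite EopE mulr_sumr big_mkcond (bigD1 a) //= addrC upd_same upd_upd.
congr (_ + _); last by case: eqP; rewrite ?mulrA.
apply: eq_bigr => b ba; rewrite upd_neq //.
by case: eqP; rewrite ?mul1r ?mul0r ?mulrA.
Qed.

Lemma Eop_comm i j k l u v c :
  Eop i j u (Eop k l v c) = Eop k l v (Eop i j u c)
    + Eop i l (fun a => u a * v a) c *+ (j == k)
    - Eop k j (fun a => u a * v a) c *+ (i == l).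
Proof.
apply/ffunP=> w; rewrite !ffunE -!EopE !Eop_comp.
rewrite [X in X + _ = _](exchange_big_dep predT) //=.
rewrite !ffunMnE -(addrA _ (_ *+ (l == i))) (addrC (_ *+ (l == i))) eq_sym -addrA.
rewrite (eq_Eop _ _ (fun a => mulrC (v a) (u a))) (eq_sym i l).
congr (_ + _); last by rewrite addrK.
apply: eq_bigr => a _; rewrite big_mkcond [RHS]big_mkcond; apply: eq_bigr => b _.
rewrite eq_sym; case: ifP => // ab.
by rewrite andbC updC // (mulrC (u b)).
Qed.

Definition Hop (i j : C) (u : T -> F) (c : wfun) : wfun :=
  Eop i i u c - Eop j j u c.

Fact Hop_is_additive i j u : zmod_morphism (Hop i j u).
Proof. by move=> c d; rewrite /Hop !raddfB /= !opprK addrACA. Qed.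

HB.instance Definition _ i j u :=
  GRing.isZmodMorphism.Build wfun wfun (Hop i j u) (Hop_is_additive i j u).

Lemma Eop_EopV i j u v c :
  Eop i j u (Eop j i v c) =
  Eop j i v (Eop i j u c) + Hop i j (fun a => u a * v a) c.
Proof. by rewrite Eop_comm !eqxx !mulr1n addrA. Qed.

Lemma Eop_Hop i j u v c : i != j ->
  Eop i j u (Hop i j v c) =
  Hop i j v (Eop i j u c) - Eop i j (fun a => u a * v a) c *+ 2.
Proof.
move=> /negPf ij; rewrite /Hop raddfB /= !(Eop_comm i j) !eqxx ij (eq_sym j).
by rewrite ij !mulr0n !mulr1n addr0 subr0 opprD addrACA -opprD mulr2n.
Qed.

Lemma Eop_commute i j k l u v c : j != k -> i != l ->
  Eop i j u (Eop k l v c) = Eop k l v (Eop i j u c).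
Proof. by move=> /negPf jk /negPf il; rewrite Eop_comm jk il !mulr0n addr0 subr0. Qed.

(** Multiplication by [D] intertwines operators attached to different functions of the position.
    This is the source of the twists by [z - z_s] and its inverse. *)
Lemma Eop_mult i j (u v : T -> F) (D : word -> F) (c : wfun) :
    (forall (w : word) a, w a = i -> u a * D (upd w a j) = D w * v a) ->
  Eop i j u [ffun w : word => D w * c w] = [ffun w : word => D w * Eop i j v c w].
Proof.
move=> uD; apply/ffunP=> w; rewrite !ffunE mulr_sumr; apply: eq_bigr => a /eqP wa.
by rewrite ffunE !mulrA uD.
Qed.

(** Each application recolours one more position from [i] to [j], and at most [#|T|] positions have
    colour [i]. *)
Lemma Eop_nilpotent i j u c : i != j -> iter #|T|.+1 (Eop i j u) c = 0.
Proof.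
move=> ij; apply/ffunP=> w; rewrite [RHS]ffunE.
have: (#|[set a | w a == i]| < #|T|.+1)%N by rewrite ltnS max_card.
elim: #|T|.+1 w => // k IH w wk; rewrite iterS EopE big1 // => a /eqP wa.
rewrite ltnS in wk.
rewrite IH ?mulr0 //; apply: leq_trans wk; apply: proper_card.
apply/properP; split; last first.
  by exists a; rewrite !inE ?wa ?upd_same // eq_sym.
apply/subsetP=> b; rewrite !inE updE; case: (eqVneq b a) => [_|//].
by rewrite eq_sym (negPf ij).
Qed.

End WordOperators.

(** * Exchanging two colours *)

Section TwoColours.
Variables (F : numFieldType) (T C : finType) (z : T -> F).
Local Notation word := {ffun T -> C}.
Local Notation wfun := {ffun word -> F}.

Implicit Types (A : {set T}) (c : wfun) (w : word).

Definition ind (A : {set T}) (a : T) : F := (a \in A)%:R.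

(** For [x = z s] the function vanishes at [s], so its operators leave the colour of [s] alone. *)
Definition shifted (A : {set T}) (x : F) (a : T) : F := ind A a * (z a - x).

Definition cnt (A : {set T}) (k : C) (w : word) : nat := #|[set a in A | w a == k]|.

Lemma ind_idem A a : ind A a * ind A a = ind A a.
Proof. by rewrite -natrM mulnb andbb. Qed.

Lemma ind_shifted A x a : ind A a * shifted A x a = shifted A x a.
Proof. by rewrite mulrA ind_idem. Qed.

Lemma cntD1 A s k w : s \in A -> cnt A k w = ((w s == k) + cnt (A :\ s) k w)%N.
Proof.
move=> sA; rewrite /cnt (cardsD1 s) !inE sA /=; congr (_ + _)%N.
by apply: eq_card => a; rewrite !inE andbA.
Qed.

Lemma Hop_ind i j A c w :
  Hop i j (ind A) c w = ((cnt A i w)%:R - (cnt A j w)%:R) * c w.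
Proof.
have sum_ind k : \sum_(a | w a == k) ind A a = (cnt A k w)%:R.
  rewrite -natr_sum; congr _%:R; rewrite /cnt -sum1_card big_mkcond [RHS]big_mkcond.
  by apply: eq_bigr => a _; rewrite !inE andbC; case: (w a == k); case: (a \in A).
by rewrite /Hop !ffunE -!EopE !Eop_diag !sum_ind mulrBl.
Qed.

Lemma Hop_weight i j A d c :
    (forall w, c w != 0 -> cnt A i w = (cnt A j w + d)%N) ->
  Hop i j (ind A) c = c *+ d.
Proof.
move=> wt; apply/ffunP=> w; rewrite Hop_ind ffunMnE -[RHS]mulr_natl.
have [->|/wt ->] := eqVneq (c w) 0; first by rewrite !mulr0.
by rewrite natrD addrC addKr.
Qed.

Lemma HopV i j u (c : wfun) : Hop j i u c = - Hop i j u c.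
Proof. by rewrite /Hop opprB. Qed.

(** The double commutator of [E_ij(u)] with [E_ji(v)] is [-2 E_ij(u^2 v)]. A square-zero condition
    thus passes from one direction to the opposite one. *)
Lemma Eop_double_commutator_sq i j u v c : i != j ->
    Eop i j u c = 0 -> Eop j i v (Eop j i v c) = 0 ->
  let K := Eop i j (fun a => u a * (u a * v a)) in K (K c) = 0.
Proof.
move=> ij uc vvc /=.
apply: (@ad_double_commutator_sq _ _ (Eop i j u) (Eop j i v)
   (Hop i j (fun a => u a * v a)) (Eop i j (fun a => u a * (u a * v a)))) => //.
- exact: wfun_torsion_free.
- by move=> d; rewrite /= Eop_EopV.
- by move=> d; rewrite /= Eop_Hop.
- by move=> d; rewrite /= Eop_commute // eq_sym.
Qed.

(** * Twisted sl_2 triples on a set of points *)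

Section SL2Triples.
Variables (i j : C) (A : {set T}) (u v : T -> F).
Hypothesis ij : i != j.
Hypothesis uv : forall a, u a * v a = ind A a.
Hypothesis Au : forall a, ind A a * u a = u a.
Hypothesis Av : forall a, ind A a * v a = v a.

Let XY (c : wfun) : Eop i j u (Eop j i v c) = Eop j i v (Eop i j u c) + Hop i j (ind A) c.
Proof.
rewrite Eop_EopV; congr (_ + _); rewrite /Hop.
by congr (_ - _); apply: eq_Eop.
Qed.

Let HY (c : wfun) :
  Hop i j (ind A) (Eop j i v c) = Eop j i v (Hop i j (ind A) c) - Eop j i v c *+ 2.
Proof.
have E := eq_Eop j i (fun a => etrans (mulrC (v a) _) (Av a)).
rewrite [in RHS]HopV raddfN /= Eop_Hop 1?eq_sym // E opprB.
by rewrite HopV addrC addKr.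
Qed.

Let XH (c : wfun) :
  Eop i j u (Hop i j (ind A) c) = Hop i j (ind A) (Eop i j u c) - Eop i j u c *+ 2.
Proof.
have E := eq_Eop i j (fun a => etrans (mulrC (u a) _) (Au a)).
by rewrite Eop_Hop // E.
Qed.

Let Ynilp (c : wfun) : iter #|T|.+1 (Eop j i v) c = 0.
Proof. by rewrite Eop_nilpotent // eq_sym. Qed.

Lemma Eop_weight0 c : Eop i j u c = 0 ->
    (forall w, c w != 0 -> cnt A i w = cnt A j w) ->
  Eop j i v c = 0.
Proof.
move=> uc wt; apply: (sl2_weight0 (@wfun_torsion_free _ _ _) XY HY Ynilp uc).
by rewrite /= (@Hop_weight _ _ _ 0) // => w /wt ->; rewrite addn0.
Qed.

Lemma Eop_weight1 c : Eop i j u c = 0 ->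
    (forall w, c w != 0 -> cnt A i w = (cnt A j w).+1) ->
  Eop j i v (Eop j i v c) = 0.
Proof.
move=> uc wt; apply: (sl2_weight1 (@wfun_torsion_free _ _ _) XY HY Ynilp uc).
by rewrite /= (@Hop_weight _ _ _ 1) // => w /wt ->; rewrite addn1.
Qed.

Lemma Eop_weightN1 c : Eop i j u (Eop i j u c) = 0 ->
    (forall w, c w != 0 -> cnt A j w = (cnt A i w).+1) ->
  Eop j i v c = 0.
Proof.
move=> uuc wt.
apply: (sl2_weightN1 (@wfun_torsion_free _ _ _) XY HY XH Ynilp uuc).
by rewrite /= HopV (@Hop_weight _ _ _ 1) // => w /wt ->; rewrite addn1.
Qed.

End SL2Triples.

(** * Swap invariance of level-one blocks for two colours *)

Section Swaps.
Hypothesis z_inj : injective z.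
Variables i j : C.
Hypothesis ij : i != j.

Lemma Eop_shift A x y c : Eop i j (ind A) c = 0 ->
  Eop i j (shifted A x) c = 0 -> Eop i j (shifted A y) c = 0.
Proof.
move=> Ac xc; have yE a : shifted A y a = shifted A x a + (x - y) * ind A a.
  by rewrite /shifted; ring.
by rewrite (eq_Eop _ _ yE) EopD xc EopZ_eq0 ?addr0.
Qed.

(** The change of origin adds a multiple of [Eop i j (ind A)], which kills [c] and commutes with
    [Eop i j (shifted A x)]. *)
Lemma Eop_shift_sq A x y c : Eop i j (ind A) c = 0 ->
    Eop i j (shifted A x) (Eop i j (shifted A x) c) = 0 ->
  Eop i j (shifted A y) (Eop i j (shifted A y) c) = 0.
Proof.
move=> Ac xxc; have yE a : shifted A y a = shifted A x a + (x - y) * ind A a.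
  by rewrite /shifted; ring.
have ji : j != i by rewrite eq_sym.
rewrite !(eq_Eop _ _ yE) !EopD (EopZ_eq0 _ Ac) addr0 xxc add0r.
by rewrite Eop_commute // (EopZ_eq0 _ Ac) raddf0.
Qed.

(** For [i < j] and [A] the full set, these are the only factors in the denominator of [P_z] that an
    exchange of the two colours can change. *)
Definition pairR (A : {set T}) (w : word) : F :=
  \prod_(s in A | w s == i) \prod_(t in A | w t == j) (z s - z t).

Lemma pairR_neq0 A w : pairR A w != 0.
Proof.
apply/prodf_neq0 => s /andP[_ /eqP si]; apply/prodf_neq0 => t /andP[_ /eqP tj].
rewrite subr_eq0; apply: contraNneq ij => /z_inj st.
by rewrite -si -tj st.
Qed.

Lemma pairRD1i A s w : s \in A -> w s = i ->
  pairR A w = pairR (A :\ s) w * \prod_(t in A :\ s | w t == j) (z s - z t).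
Proof.
move=> sA si; rewrite /pairR (bigD1 s) /= ?sA ?si ?eqxx // mulrC.
have E t : ((t \in A) && (w t == j)) = ((t \in A :\ s) && (w t == j)).
  rewrite !inE; case: (eqVneq t s) => //= ->.
  by rewrite si (negPf ij) andbF.
congr (_ * _); last exact: eq_bigl.
apply: eq_big => [t|t _]; last exact: eq_bigl.
by rewrite !inE andbC andbA.
Qed.

Lemma pairRD1j A s w : s \in A -> w s = j ->
  pairR A w = pairR (A :\ s) w * \prod_(t in A :\ s | w t == i) (z t - z s).
Proof.
move=> sA sj; rewrite /pairR -big_split /=; apply: eq_big => [t|t].
  rewrite !inE; case: (eqVneq t s) => //= ->.
  by rewrite sj eq_sym (negPf ij) andbF.
move=> _; rewrite (bigD1 s) /= ?sA ?sj ?eqxx // mulrC; congr (_ * _).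
by apply: eq_bigl => t'; rewrite !inE andbC andbA.
Qed.

Definition swap (w : word) (a b : T) : word := upd (upd w a j) b i.

(** [d] is the sl_2 weight of the words compared, and [N] drives the induction. *)
Definition swap_invariant (A : {set T}) (d N : nat) (c : wfun) : Prop :=
  forall w a b, a \in A -> b \in A -> w a = i -> w b = j ->
    cnt A j w = N -> cnt A i w = (N + d)%N ->
  c w * pairR A w = c (swap w a b) * pairR A (swap w a b).

(* The level-one conditions for the colours [i], [j] on the points of [A], when
   [i] and [j] occur equally often, resp. when [i] occurs once more than [j].
   In the first case the shift [x] is irrelevant because [Eop i j (ind A) c = 0];
   quantifying over it allows any point to be moved to the origin. *)
Definition block0 (A : {set T}) (c : wfun) : Prop :=
  [/\ forall w, c w != 0 -> cnt A i w = cnt A j w, Eop i j (ind A) c = 0 &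
      forall x, Eop i j (shifted A x) (Eop i j (shifted A x) c) = 0].

Definition block1 (A : {set T}) (c : wfun) : Prop :=
  [/\ forall w, c w != 0 -> cnt A i w = (cnt A j w).+1, Eop i j (ind A) c = 0 &
      forall x, Eop i j (shifted A x) c = 0].

(* Restriction to the words with colour [i] (resp. [j]) at [s], rescaled by the
   factors of [pairR A] that involve [s]. *)
Definition remove_i (A : {set T}) (s : T) (w : word) : F :=
  (w s == i)%:R * \prod_(t in A :\ s | w t == j) (z s - z t).

Definition remove_j (A : {set T}) (s : T) (w : word) : F :=
  (w s == j)%:R * \prod_(t in A :\ s | w t == i) (z t - z s).

(** Recolouring [a] from [i] to [j] adds the factor [z s - z a] to [remove_i]; this factor vanishes
    at [a = s]. *)
Lemma Eop_remove_i A s g (c : wfun) : s \in A ->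
  Eop i j (fun a => ind (A :\ s) a * g a) [ffun w : word => remove_i A s w * c w] =
  [ffun w : word => remove_i A s w * Eop i j (fun a => ind A a * (z s - z a) * g a) c w].
Proof.
move=> sA; apply: Eop_mult => w a wa; rewrite /ind !inE.
case: (eqVneq a s) => [->|as_] /=; first by rewrite subrr !(mulr0, mul0r).
case: (boolP (a \in A)) => aA; last by rewrite !(mulr0, mul0r).
rewrite /remove_i upd_neq 1?eq_sym // [in LHS](bigD1 a) /=; last first.
  by rewrite !inE as_ aA upd_same eqxx.
rewrite (eq_bigl (fun t => (t \in A :\ s) && (w t == j))).
  by ring.
move=> t; rewrite !inE updE; case: (eqVneq t a) => [->|_]; last by rewrite andbT.
by rewrite wa (negPf ij) !andbF.
Qed.

(** Recolouring [a] from [i] to [j] takes the factor [z a - z s] out of [remove_j], hence the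
    division. *)
Lemma Eop_remove_j A s g (c : wfun) : s \in A ->
  Eop i j (fun a => ind (A :\ s) a * g a) [ffun w : word => remove_j A s w * c w] =
  [ffun w : word => remove_j A s w *
     Eop i j (fun a => ind (A :\ s) a * (g a / (z a - z s))) c w].
Proof.
move=> sA; apply: Eop_mult => w a wa; rewrite /ind !inE.
case: (eqVneq a s) => [as_|as_] /=.
  by rewrite /remove_j -as_ wa (negPf ij) !(mulr0, mul0r).
case: (boolP (a \in A)) => aA; last by rewrite !(mulr0, mul0r).
have zas : z a - z s != 0 by rewrite subr_eq0 (inj_eq z_inj).
rewrite /remove_j upd_neq 1?eq_sym // [in RHS](bigD1 a) /=; last first.
  by rewrite !inE as_ aA wa eqxx.
rewrite (eq_bigl (fun t => (t \in A :\ s) && (w t == i) && (t != a))).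
  by field.
move=> t; rewrite !inE updE; case: (eqVneq t a) => [->|_]; last by rewrite andbT.
by rewrite [j == i]eq_sym (negPf ij) !andbF.
Qed.

Lemma ind_shiftedD1 A s a : ind (A :\ s) a * (z a - z s) = shifted A (z s) a.
Proof.
rewrite /shifted /ind !inE; case: (eqVneq a s) => [->|_] //=.
by rewrite subrr !mulr0.
Qed.

(** Put [x = z - z_s]. Weight 1 gives [E_ji(1)^2 c = 0], and the double commutator with [E_ij(x)]
    turns this into [E_ij(x^2)^2 c = 0]. After rescaling, [E_ij(1)] and [E_ij(x)] on the other
    points correspond to [-E_ij(x)] and [-E_ij(x^2)] on [c]. *)
Lemma block1_remove A s c : s \in A -> block1 A c ->
  block0 (A :\ s) [ffun w : word => remove_i A s w * c w].
Proof.
move=> sA [wt c0 cx].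
have cc : forall x, let u := fun a => shifted A x a * shifted A x a in
    Eop i j u (Eop i j u c) = 0.
  move=> x; have /= := @Eop_double_commutator_sq i j (shifted A x) (ind A) c ij (cx x).
  have E a : shifted A x a * (shifted A x a * ind A a) = shifted A x a * shifted A x a.
    by rewrite (mulrC _ (ind A a)) ind_shifted.
  rewrite !(eq_Eop _ _ E); apply.
  by apply: (Eop_weight1 (A := A) ij _ _ c0 wt) => a; rewrite ind_idem.
have R0 : Eop i j (ind (A :\ s)) [ffun w : word => remove_i A s w * c w] = 0.
  rewrite -(eq_Eop _ _ (fun a => mulr1 (ind (A :\ s) a))) (Eop_remove_i (fun=> 1)) //.
  have E a : ind A a * (z s - z a) * 1 = (-1) * shifted A (z s) a.
    by rewrite /shifted; ring.
  rewrite (eq_Eop _ _ E) EopZ_eq0 //; apply/ffunP=> w; rewrite !ffunE mulr0 //.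
split=> // [w|x].
  rewrite ffunE mulf_eq0 negb_or => /andP[]; rewrite /remove_i.
  case: (w s =P i) => [si _ |_]; last by rewrite /= mul0r eqxx.
  move=> /wt; rewrite !(cntD1 _ _ sA) si eqxx (negPf ij) add1n add0n.
  by case.
apply: (Eop_shift_sq (x := z s)) => //.
rewrite !(Eop_remove_i (fun a => z a - z s)) //.
have E a : ind A a * (z s - z a) * (z a - z s) =
    (-1) * (shifted A (z s) a * shifted A (z s) a).
  rewrite -[in RHS]ind_shifted /shifted; have := ind_idem A a; move: (ind A a) => e ee.
  by rewrite -[in LHS]ee; ring: ee.
rewrite !(eq_Eop _ _ E); apply/ffunP=> w; rewrite ffunE.
have -> : Eop i j (fun a => (-1) * (shifted A (z s) a * shifted A (z s) a))
   (Eop i j (fun a => (-1) * (shifted A (z s) a * shifted A (z s) a)) c) = 0.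
  rewrite (_ : Eop i j _ c = - Eop i j (fun a => shifted A (z s) a * shifted A (z s) a) c).
    by rewrite raddfN /= EopZ_eq0 ?oppr0 // cc.
  by apply/ffunP=> v; rewrite EopZ mulN1r [RHS]ffunE.
by rewrite !ffunE mulr0.
Qed.

(** Put [x = z - z_s]. Weight 0 gives [E_ji(1) c = 0], and the double commutator with [E_ij(x)]
    gives [E_ji(x)^2 c = 0]. On the slice with colour [j] at [s], the twisted triple then yields
    [E_ij(1/x) v = 0], which rescaling turns into the singular vector equation. *)
Lemma block0_remove A s c : s \in A -> block0 A c ->
  block1 (A :\ s) [ffun w : word => remove_j A s w * c w].
Proof.
move=> sA [wt c0 cx].
have ji : j != i by rewrite eq_sym.
pose v : wfun := [ffun w : word => (w s == j)%:R * c w].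
have FFc : Eop j i (shifted A (z s)) (Eop j i (shifted A (z s)) c) = 0.
  have /= := @Eop_double_commutator_sq j i (ind A) (shifted A (z s)) c ji.
  have E a : ind A a * (ind A a * shifted A (z s) a) = shifted A (z s) a.
    by rewrite !ind_shifted.
  rewrite !(eq_Eop _ _ E); apply=> //.
  by apply: (Eop_weight0 (A := A) ij _ _ c0 wt) => a; rewrite ind_idem.
(* An operator whose function vanishes at [s] commutes with fixing the colour of [s]. *)
have slice g (b : wfun) : Eop j i (fun a => ind (A :\ s) a * g a)
      [ffun w : word => (w s == j)%:R * b w] =
    [ffun w : word => (w s == j)%:R * Eop j i (fun a => ind (A :\ s) a * g a) b w].
  apply: (Eop_mult (D := fun w : word => (w s == j)%:R)) => w a wa.
  case: (eqVneq a s) => [->|as_]; first by rewrite /ind !inE eqxx !(mul0r, mulr0).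
  by rewrite upd_neq 1?eq_sym // mulrC.
have FFv : Eop j i (shifted A (z s)) (Eop j i (shifted A (z s)) v) = 0.
  rewrite -!(eq_Eop _ _ (ind_shiftedD1 A s)) !slice !(eq_Eop _ _ (ind_shiftedD1 A s)).
  by rewrite FFc; apply/ffunP=> w; rewrite !ffunE mulr0.
(* [v] has weight 1 and is killed by the square of the lowering operator of the
   triple twisted by [z - z s], hence lies in copies of the vector representation. *)
have inv0 : Eop i j (fun a => ind (A :\ s) a * (1 / (z a - z s))) v = 0.
  apply: (Eop_weightN1 (A := A :\ s) (u := shifted A (z s)) ji) => //.
  - move=> a; rewrite -ind_shiftedD1 mulrACA ind_idem /ind !inE.
    case: (eqVneq a s) => [_|as_] /=; first by rewrite mul0r.
    by rewrite mul1r mulfV ?mulr1 // subr_eq0 (inj_eq z_inj).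
  - by move=> a; rewrite -ind_shiftedD1 mulrA ind_idem.
  - by move=> a; rewrite mulrA ind_idem.
  move=> w; rewrite ffunE; case: (w s =P j) => [sj|_]; last by rewrite /= mul0r eqxx.
  by rewrite mul1r => /wt; rewrite !(cntD1 _ _ sA) sj eqxx (negPf ji) add1n add0n => ->.
have vE : [ffun w : word => remove_j A s w * c w] =
    [ffun w : word => (\prod_(t in A :\ s | w t == i) (z t - z s)) * v w].
  by apply/ffunP=> w; rewrite !ffunE /remove_j mulrA; congr (_ * _); rewrite mulrC.
have R0 : Eop i j (ind (A :\ s)) [ffun w : word => remove_j A s w * c w] = 0.
  have idem : [ffun w : word => remove_j A s w * c w] =
      [ffun w : word => remove_j A s w * v w].
    apply/ffunP=> w; rewrite !ffunE /remove_j; by case: eqP => _; rewrite /= ?mul1r ?mul0r.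
  rewrite idem -(eq_Eop _ _ (fun a => mulr1 (ind (A :\ s) a))) (Eop_remove_j (fun=> 1)) //.
  by rewrite inv0; apply/ffunP=> w; rewrite !ffunE mulr0.
split=> // [w|x].
  rewrite ffunE mulf_eq0 negb_or => /andP[]; rewrite /remove_j.
  case: (w s =P j) => [sj _ |_]; last by rewrite /= mul0r eqxx.
  by move=> /wt; rewrite !(cntD1 _ _ sA) sj eqxx (negPf ji) add1n add0n.
apply: (Eop_shift (x := z s)) => //.
rewrite (Eop_remove_j (fun a => z a - z s)) //.
apply/ffunP=> w; rewrite !ffunE /remove_j.
case: eqP => [sj|_]; last by rewrite /= !mul0r.
(* The twist cancels, and [s], having colour [j], is not among the positions of colour [i] summed
   over. *)
rewrite (_ : \sum_(a | _) _ = Eop i j (ind A) c w); first by rewrite c0 ffunE mulr0.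
rewrite EopE; apply: eq_bigr => a /eqP wa; rewrite /ind !inE.
have as_ : a != s by apply: contraNneq ij => as_; rewrite -wa as_ sj.
by rewrite as_ mulfV ?mulr1 // subr_eq0 (inj_eq z_inj).
Qed.

Lemma swapE w a b t :
  swap w a b t = if t == b then i else if t == a then j else w t.
Proof. by rewrite /swap !updE. Qed.

Lemma cnt_swap A k w a b : a \in A -> b \in A -> w a = i -> w b = j ->
  cnt A k (swap w a b) = cnt A k w.
Proof.
move=> aA bA wa wb.
have ba : b != a by apply: contraNneq ij => ba; rewrite -wa -ba wb.
have bAa : b \in A :\ a by rewrite !inE ba bA.
rewrite !(cntD1 _ _ aA) !(cntD1 _ _ bAa) !swapE !eqxx [a == b]eq_sym (negPf ba) wa wb.
rewrite addnCA; congr (_ + (_ + _))%N; rewrite /cnt; apply: eq_card => t; rewrite !inE swapE.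
by case: (t == b); case: (t == a).
Qed.

(** The swap does not touch the removed point [x], so both sides gain the same kind of factor [s x],
    the one completing [pairR] from [A :\ x] to [A]. The choice of [x] may depend on the word and on
    [a], [b]. *)
Lemma swap_invariant_remove A d d' N N' (s : T -> word -> F) c :
    (forall w a b, a \in A -> b \in A -> w a = i -> w b = j ->
       cnt A j w = N -> cnt A i w = (N + d)%N ->
     exists2 x, [/\ x \in A, x != a & x != b] &
       [/\ cnt (A :\ x) j w = N', cnt (A :\ x) i w = (N' + d')%N,
          swap_invariant (A :\ x) d' N' [ffun v : word => s x v * c v] &
          forall v : word, v x = w x ->
            s x v * pairR (A :\ x) v = pairR A v]) ->
  swap_invariant A d N c.
Proof.
move=> rem w a b aA bA wa wb Nj Ni.
have [x [xA xa xb] [N'j N'i inv sR]] := rem w a b aA bA wa wb Nj Ni.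
have swx : swap w a b x = w x by rewrite swapE (negPf xa) (negPf xb).
have := inv w a b; rewrite !ffunE !inE !(eq_sym _ x) xa xb aA bA.
move=> /(_ isT isT wa wb N'j N'i).
by rewrite !(mulrC (s x _)) -!mulrA !sR.
Qed.

(** In [A] only [a] and [b] have colour [i] or [j], so [pairR] is [z a - z b], which the swap
    negates. Singularity at the word coloured [i] at both positions says that [c] is negated as
    well. *)
Lemma swap_invariant_base A c : block0 A c -> swap_invariant A 0 1 c.
Proof.
move=> [wt c0 _] w a b aA bA wa wb Nj Ni.
have ba : b != a by apply: contraNneq ij => ba; rewrite -wa -ba wb.
have bAa : b \in A :\ a by rewrite !inE ba bA.
have none k v t : cnt (A :\ a :\ b) k v = 0%N -> t \in A -> v t = k -> t \in [set a; b].
  move=> /eqP; rewrite cards_eq0 => /eqP/setP/(_ t); rewrite !inE => + tA vt.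
  by rewrite vt eqxx tA; case: (t == a); case: (t == b).
have jw : cnt (A :\ a :\ b) j w = 0%N.
  move: Nj; rewrite (cntD1 _ _ aA) (cntD1 _ _ bAa) wa wb eqxx (negPf ij); lia.
have iw : cnt (A :\ a :\ b) i w = 0%N.
  move: Ni; rewrite (cntD1 _ _ aA) (cntD1 _ _ bAa) wa wb eqxx; lia.
have RE (v : word) x y : [set x; y] = [set a; b] -> v x = i -> v y = j ->
    (forall t, t \notin [set a; b] -> v t = w t) -> pairR A v = z x - z y.
  move=> xy vx vy vw.
  have abA t : t \in [set a; b] -> t \in A by rewrite !inE => /orP[]/eqP->.
  have xA : x \in A by apply: abA; rewrite -xy !inE eqxx.
  have yA : y \in A by apply: abA; rewrite -xy !inE eqxx orbT.
  have only (k : C) p q : v p = k -> p \in A -> p \in [set a; b] -> v q <> k ->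
      [set p; q] = [set a; b] -> cnt (A :\ a :\ b) k w = 0%N ->
      forall t, ((t \in A) && (v t == k)) = (t == p).
    move=> vp pA pab vq pq c0' t; apply/andP/eqP => [[tA /eqP vt]|->]; last by rewrite vp pA.
    have : t \in [set a; b].
      apply/negPn/negP=> tn; move/negP: (tn); apply.
      by apply: (none k w) => //; rewrite -vw.
    by rewrite -pq !inE => /orP[]/eqP // tq; rewrite tq in vt.
  rewrite /pairR (eq_bigl (pred1 x)); last first.
    move=> s; apply: (only i x y) => //; first by rewrite -xy !inE eqxx.
    by rewrite vy => /eqP; rewrite eq_sym (negPf ij).
  rewrite big_pred1_eq (eq_bigl (pred1 y)) ?big_pred1_eq //.
  move=> s; apply: (only j y x) => //; first by rewrite -xy !inE eqxx orbT.
    by rewrite vx => /eqP; rewrite (negPf ij).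
  by rewrite setUC.
rewrite (RE w a b) // (RE (swap w a b) b a) ?swapE ?eqxx 1?eq_sym ?(negPf ba) //; first last.
- by move=> t; rewrite !inE negb_or swapE => /andP[/negPf -> /negPf ->].
- by rewrite setUC.
have : Eop i j (ind A) c (upd w b i) = 0 by rewrite c0 ffunE.
rewrite EopE (bigD1 a) /=; last by rewrite upd_neq 1?eq_sym // wa.
rewrite (bigD1 b) /=; last by rewrite upd_same eqxx ba.
rewrite big1 ?addr0 => [|t /andP[/andP[ti ta] tb]]; last first.
  rewrite /ind; case: (boolP (t \in A)) => tA; last by rewrite mul0r.
  have : t \in [set a; b].
    by apply: (none i w) => //; move: ti; rewrite updE (negPf tb) => /eqP.
  by rewrite !inE (negPf ta) (negPf tb).
rewrite /ind aA bA !mul1r upd_upd -{2}wb upd_id.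
rewrite -updC 1?eq_sym // -/(swap w a b) => /eqP; rewrite addr_eq0 => /eqP ->.
by ring.
Qed.

(** From [block1] a point of colour [i] is removed and the number of letters [j] stays; from
    [block0] a point of colour [j] is removed and that number drops. The counts always leave a point
    of the required colour besides [a] and [b]. *)
Lemma swap_invariant_block N :
  (forall A c, block0 A c -> swap_invariant A 0 N.+1 c) /\
  (forall A c, block1 A c -> swap_invariant A 1 N.+1 c).
Proof.
have step1 n : (forall A c, block0 A c -> swap_invariant A 0 n.+1 c) ->
    forall A c, block1 A c -> swap_invariant A 1 n.+1 c.
  move=> IH A c bc; apply: (@swap_invariant_remove _ _ 0 _ n.+1 (remove_i A)).
  move=> w a b aA bA wa wb Nj Ni.
  have : (0 < cnt (A :\ a) i w)%N.
    by move: Ni; rewrite (cntD1 _ _ aA) wa eqxx; lia.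
  rewrite card_gt0 => /set0Pn[x]; rewrite !inE => /andP[/andP[xa xA] /eqP wx].
  exists x; first by split=> //; apply: contraNneq ij => xb; rewrite -wx -wb xb.
  move: Nj Ni; rewrite !(cntD1 _ _ xA) wx eqxx (negPf ij) => Nj Ni; split.
  - by rewrite -Nj.
  - by move: Ni; lia.
  - exact/IH/block1_remove.
  move=> v vx; rewrite (@pairRD1i A x) // mulrC; congr (_ * _).
  by rewrite /remove_i vx eqxx mul1r.
elim: N => [|n [IH0 IH1]].
  by split; [exact: swap_invariant_base | apply: step1; exact: swap_invariant_base].
suff H : forall A c, block0 A c -> swap_invariant A 0 n.+2 c by split=> //; exact: step1.
move=> A c bc; apply: (@swap_invariant_remove _ _ 1 _ n.+1 (remove_j A)).
move=> w a b aA bA wa wb Nj Ni.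
have : (0 < cnt (A :\ b) j w)%N.
  by move: Nj; rewrite (cntD1 _ _ bA) wb eqxx; lia.
rewrite card_gt0 => /set0Pn[x]; rewrite !inE => /andP[/andP[xb xA] /eqP wx].
exists x; first by split=> //; apply: contraNneq ij => xa; rewrite -wx -wa xa.
move: Nj Ni; rewrite !(cntD1 _ _ xA) wx eqxx [j == i]eq_sym (negPf ij) => Nj Ni; split.
- by move: Nj; lia.
- by move: Ni; lia.
- exact/IH1/block0_remove.
move=> v vx; rewrite (@pairRD1j A x) // mulrC; congr (_ * _).
by rewrite /remove_j vx eqxx mul1r.
Qed.

End Swaps.
End TwoColours.

(** * From the extreme colours to all pairs of colours *)

Section Propagation.
Variables (F : numFieldType) (T : finType) (m k N : nat) (z : T -> F).
Local Notation C := 'I_m.+2.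
Local Notation word := {ffun T -> C}.
Local Notation wfun := {ffun word -> F}.
Local Notation one := (ind F [set: T]).
Local Notation zz := (shifted z [set: T] 0).
Implicit Types (w : word) (i j q : C) (u v : T -> F) (c : wfun).

Lemma Eop_bracket_eq0 i q j u v c : i != j ->
  Eop i q u c = 0 -> Eop q j v c = 0 -> Eop i j (fun a => u a * v a) c = 0.
Proof.
move=> /negPf ij uc vc; have := Eop_comm i q q j u v c.
by rewrite uc vc !raddf0 eqxx ij mulr1n mulr0n subr0 add0r => <-.
Qed.

(** [E_ij(uv)] is the commutator of [E_iq(u)] and [E_qj(v)] and commutes with both, so
    [central_commutator_sq] applies. *)
Lemma Eop_bracket_sq_r i q j u v c : i != q -> i != j -> q != j ->
    Eop i q u c = 0 -> Eop q j v (Eop q j v c) = 0 ->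
  let G := Eop i j (fun a => u a * v a) in G (G c) = 0.
Proof.
move=> iq ij qj uc vvc /=.
apply: (@central_commutator_sq _ _ (Eop i q u) (Eop q j v)
  (Eop i j (fun a => u a * v a)) c _ _ _ uc vvc); first exact: wfun_torsion_free.
- by move=> d /=; rewrite Eop_comm eqxx (negPf ij) mulr1n mulr0n subr0.
- by move=> d /=; rewrite Eop_commute // eq_sym.
- by move=> d /=; rewrite Eop_commute // eq_sym.
Qed.

Lemma Eop_bracket_sq_l i q j u v c : i != q -> i != j -> q != j ->
    Eop q j v c = 0 -> Eop i q u (Eop i q u c) = 0 ->
  let G := Eop i j (fun a => u a * v a) in G (G c) = 0.
Proof.
move=> iq ij qj vc uuc /=.
(* The commutator is now taken in the other order; its sign disappears in the square. *)
have GN d : Eop i j (fun a => -1 * (u a * v a)) d = - Eop i j (fun a => u a * v a) d.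
  by apply/ffunP=> w; rewrite EopZ mulN1r [RHS]ffunE.
suff: Eop i j (fun a => -1 * (u a * v a)) (Eop i j (fun a => -1 * (u a * v a)) c) = 0.
  by rewrite !GN raddfN opprK.
apply: (@central_commutator_sq _ _ (Eop q j v) (Eop i q u)
  (Eop i j (fun a => -1 * (u a * v a))) c _ _ _ vc uuc).
- exact: wfun_torsion_free.
- move=> d /=; rewrite GN Eop_comm eqxx [j == i]eq_sym (negPf ij) mulr1n mulr0n addr0.
  by congr (_ - _); apply: eq_Eop => a; rewrite mulrC.
- by move=> d /=; rewrite Eop_commute // eq_sym.
- by move=> d /=; rewrite Eop_commute // eq_sym.
Qed.

Variable lambda : C -> nat.
Hypothesis hk : (k <= m.+2)%N.
Hypothesis hlambda : forall i, lambda i = if (i < k)%N then N.+1 else N.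
Variable c : wfun.
Hypothesis wt : forall w, c w != 0 -> forall i, cnt setT i w = lambda i.
Hypothesis singular : forall i j, (i < j)%N -> Eop i j one c = 0.
Hypothesis level1 :
  iter (1 - (lambda ord0 - lambda ord_max)).+1 (Eop ord0 ord_max zz) c = 0.

Let one_idem a : one a * one a = one a.
Proof. exact: ind_idem. Qed.

Let lt_neq i j : (i < j)%N -> i != j.
Proof. by move=> ij; apply: contraTneq ij => ->; rewrite ltnn. Qed.

Lemma lowering_eq0 i j : (i < j)%N -> lambda i = lambda j -> Eop j i one c = 0.
Proof.
move=> ij lij; apply: (Eop_weight0 (A := setT) (u := one)) (singular ij) _ => //.
  exact: lt_neq.
by move=> w cw; rewrite !wt.
Qed.

Lemma lowering_sq_eq0 i j : (i < j)%N -> lambda i = (lambda j).+1 ->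
  Eop j i one (Eop j i one c) = 0.
Proof.
move=> ij lij; apply: (Eop_weight1 (A := setT) (u := one)) (singular ij) _ => //.
  exact: lt_neq.
by move=> w cw; rewrite !wt.
Qed.

Let zz_one a : zz a * one a = zz a.
Proof. by rewrite mulrC ind_shifted. Qed.

Let one_zz a : one a * zz a = zz a.
Proof. exact: ind_shifted. Qed.

Let C0 : C := ord0.
Let C1 : C := ord_max.

Let lt_C1 i : i != C1 -> (i < C1)%N.
Proof. by move=> ne; rewrite ltn_neqAle -ltnS ltn_ord andbT. Qed.

Let gt_C0 i : i != C0 -> (C0 < i)%N.
Proof. by rewrite lt0n. Qed.

(** Brackets with lowering operators that kill [c] move the ends of the pair of extreme colours
    within blocks of equal entries of [lambda]. When both values occur, pairs inside one block are
    reached through a lowering operator across the blocks, whose square kills [c]. *)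
Lemma raising_propagates i j : (i < j)%N ->
  if lambda i == lambda j then Eop i j zz (Eop i j zz c) = 0
  else Eop i j zz c = 0.
Proof.
move=> ij; have nij := lt_neq ij.
have C01 : C0 != C1 by [].
have [mixed|] := boolP ((0 < k) && (k < m.+2))%N; last first.
  move=> nmixed; have eql a b : lambda a = lambda b.
    have := ltn_ord a; have := ltn_ord b; move: nmixed hk; rewrite !hlambda.
    case: k => [|k'] //=; rewrite -leqNgt => k'm km am bm.
    by rewrite (leq_trans bm k'm) (leq_trans am k'm).
  rewrite (eql i j) eqxx.
  (* For constant [lambda] the exponent in [level1] is 2. *)
  have top : Eop C0 C1 zz (Eop C0 C1 zz c) = 0.
    by move: level1; rewrite (eql ord0 ord_max) subnn.
  have col : Eop i C1 zz (Eop i C1 zz c) = 0.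
    have [->//|i0] := eqVneq i C0.
    have iC1 : i != C1 by apply: lt_neq; exact: leq_trans ij (leq_ord j).
    have /= := Eop_bracket_sq_r i0 iC1 C01 (lowering_eq0 (gt_C0 i0) (eql _ _)) top.
    by rewrite !(eq_Eop _ _ one_zz).
  have [->//|j1] := eqVneq j C1.
  have iC1 : i != C1 by apply: lt_neq; exact: leq_trans ij (leq_ord j).
  have C1j : C1 != j by rewrite eq_sym.
  have /= := Eop_bracket_sq_l iC1 nij C1j (lowering_eq0 (lt_C1 j1) (eql _ _)) col.
  by rewrite !(eq_Eop _ _ zz_one).
have [k0 km] := andP mixed.
have l0 : lambda C0 = N.+1 by rewrite hlambda k0.
have l1 : lambda C1 = N by rewrite hlambda ltnNge -ltnS km.
(* The extreme entries differ by 1, so the exponent in [level1] is 1. *)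
have top : Eop C0 C1 zz c = 0.
  by move: level1; rewrite -/C0 -/C1 l0 l1 subSnn subnn.
have col a : lambda a = N.+1 -> a != C1 -> Eop a C1 zz c = 0.
  move=> la a1; have [->//|a0] := eqVneq a C0.
  have := Eop_bracket_eq0 a1 (lowering_eq0 (gt_C0 a0) (etrans l0 (esym la))) top.
  by rewrite (eq_Eop _ _ one_zz).
have main a b : lambda a = N.+1 -> lambda b = N -> a != b -> Eop a b zz c = 0.
  move=> la lb ab.
  have a1 : a != C1 by apply: contra_eqN l1 => /eqP <-; rewrite la; apply/eqP => /esym/n_Sn.
  have [->|b1] := eqVneq b C1; first exact: col.
  have := Eop_bracket_eq0 ab (col a la a1) (lowering_eq0 (lt_C1 b1) (etrans lb (esym l1))).
  by rewrite (eq_Eop _ _ zz_one).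
have [ik|ik] := ltnP i k; have li := hlambda i; rewrite ?ik ?ltnNge ?ik /= in li;
  have [jk|jk] := ltnP j k; have lj := hlambda j; rewrite ?jk ?ltnNge ?jk /= in lj.
- rewrite li lj eqxx.
  have i1 : i != C1 by apply: lt_neq; exact: leq_trans ij (leq_ord j).
  have j1 : j != C1 by apply: contra_eqN l1 => /eqP <-; rewrite lj; apply/eqP => /esym/n_Sn.
  have C1j : C1 != j by rewrite eq_sym.
  (* Both colours carry [N.+1]: the path from [i] to [j] goes through the last colour. *)
  have := lowering_sq_eq0 (lt_C1 j1); rewrite lj l1 => /(_ erefl) low.
  have /= := Eop_bracket_sq_r i1 nij C1j (col i li i1) low.
  by rewrite !(eq_Eop _ _ zz_one).
- by rewrite li lj eqn_leq ltnn; exact: main.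
- by move: (leq_trans ij (leq_trans (ltnW jk) ik)); rewrite ltnn.
- rewrite li lj eqxx.
  have i0 : i != C0 by apply: contra_eqN l0 => /eqP <-; rewrite li; apply/eqP => /n_Sn.
  have j0 : C0 != j by apply: lt_neq; exact: leq_ltn_trans (leq0n i) ij.
  (* Both colours carry [N]: the path from [i] to [j] goes through the first colour. *)
  have := lowering_sq_eq0 (gt_C0 i0); rewrite li l0 => /(_ erefl) low.
  have /= := Eop_bracket_sq_l i0 nij j0 (main C0 j l0 lj j0) low.
  by rewrite !(eq_Eop _ _ one_zz).
Qed.

Lemma swap_proportional (z_inj : injective z) i j w a b : (i < j)%N ->
    w a = i -> w b = j -> (forall l, cnt setT l w = lambda l) ->
  c w * pairR z i j setT w = c (swap i j w a b) * pairR z i j setT (swap i j w a b).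
Proof.
move=> ij wa wb wl; have nij := lt_neq ij.
have := raising_propagates ij.
have lj0 : (0 < lambda j)%N.
  by rewrite -wl card_gt0; apply/set0Pn; exists b; rewrite !inE wb eqxx.
case: eqP => [lij|lij] E.
  (* [swap_invariant_block] speaks of [N.+1] letters [j]; [lambda j] is positive because [b] has
     colour [j]. *)
  have [+ _] := swap_invariant_block z_inj nij (lambda j).-1.
  move=> /(_ setT c); apply; rewrite ?inE ?wl ?prednK ?addn0 //.
  split=> [w' /wt cw||x]; [by rewrite !cw | exact: singular |].
  by apply: (Eop_shift_sq nij (x := 0)) => //; exact: singular.
have lij' : lambda i = (lambda j).+1.
  move: lij; rewrite !hlambda; case: ltnP => ik; case: ltnP => jk //.
  by move: (leq_trans ij (leq_trans (ltnW jk) ik)); rewrite ltnn.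
have [_ +] := swap_invariant_block z_inj nij (lambda j).-1.
move=> /(_ setT c); apply; rewrite ?inE ?wl ?prednK ?addn1 //.
split=> [w' /wt cw||x]; [by rewrite !cw | exact: singular |].
by apply: (Eop_shift (x := 0)) => //; exact: singular.
Qed.

End Propagation.

(** * Coefficients of the partition sum *)

Section DividedDifferences.
Variables (F : fieldType) (T : finType) (z : T -> F).
Hypothesis z_inj : injective z.

(** Lagrange interpolation writes [f] as a combination of monic polynomials of degree [#|S|.-1]; the
    coefficients in that degree are compared. *)
Lemma divided_difference (S : {set T}) (f : {poly F}) : (size f <= #|S|)%N ->
  \sum_(a in S) f.[z a] / (\prod_(b in S | b != a) (z a - z b)) = f`_(#|S|.-1).
Proof.
move=> fS.
pose P a := \prod_(b in S | b != a) ('X - (z b)%:P).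
have PE a : P a = \prod_(x <- [seq z b | b <- enum (S :\ a)]) ('X - x%:P).
  rewrite big_map big_enum; apply: eq_bigl => b.
  by rewrite !inE andbC.
have sizeP a : a \in S -> size (P a) = #|S|.
  by move=> aS; rewrite PE size_prod_XsubC size_map -cardE (cardsD1 a S) aS.
have monicP a : P a \is monic by rewrite PE monic_prod_XsubC.
have Pz a : (P a).[z a] = \prod_(b in S | b != a) (z a - z b).
  by rewrite horner_prod; apply: eq_bigr => b _; rewrite !hornerE.
have Pz0 a b : b \in S -> b != a -> (P a).[z b] = 0.
  by move=> bS ba; rewrite /P (bigD1 b) /= ?bS // hornerM !hornerE subrr mul0r.
have Pzn a : (P a).[z a] != 0.
  rewrite Pz; apply/prodf_neq0 => b /andP[_ ba].
  by rewrite subr_eq0 (inj_eq z_inj) eq_sym.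
pose L := \sum_(a in S) (f.[z a] / (P a).[z a]) *: P a.
(* The difference has size at most [#|S|] but vanishes at [#|S|] distinct points. *)
have LE : f = L.
  apply/eqP; rewrite -subr_eq0; apply/negPn/negP => fL.
  have := @max_poly_roots F (f - L) [seq z a | a <- enum S] fL.
  rewrite size_map -cardE map_inj_uniq // enum_uniq.
  have -> : all (root (f - L)) [seq z a | a <- enum S].
    apply/allP => _ /mapP[b bS ->]; rewrite mem_enum in bS.
    rewrite rootE !hornerE horner_sum (bigD1 b) //= big1 => [|a /andP[_ ab]].
      by rewrite addr0 hornerZ mulfVK // subrr.
    by rewrite hornerZ (Pz0 a b bS) ?mulr0 // eq_sym.
  move=> /(_ isT isT); rewrite ltnNge; case/negP.
  apply: leq_trans (size_polyD _ _) _; rewrite size_polyN geq_max fS.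
  apply: leq_trans (size_sum _ _ _) _; apply/bigmax_leqP => a aS.
  by apply: leq_trans (size_scale_leq _ _) _; rewrite sizeP.
rewrite [in RHS]LE coef_sum; apply: eq_bigr => a aS.
have := monicP a; rewrite coefZ monicE lead_coefE sizeP // => /eqP ->.
by rewrite mulr1 Pz.
Qed.

End DividedDifferences.

(** * Conformal block equations for the partition sum *)

Section PartitionSum.
Variables (F : numFieldType) (T : finType) (m : nat) (z : T -> F).
Hypothesis z_inj : injective z.
Local Notation C := 'I_m.
Local Notation word := {ffun T -> C}.
Local Notation wfun := {ffun word -> F}.
Local Notation cntT := (@cnt T C setT).
Local Notation zz := (shifted z [set: T] 0).
Implicit Types (w : word) (i j l : C) (mu : C -> nat).

Definition word_resultant w : F := \prod_s \prod_(t | (w s < w t)%N) (z s - z t).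

(** The content [mu] is arbitrary because raising operators lead from one content to another. *)
Definition psum mu : wfun :=
  [ffun w : word => if [forall l, cntT l w == mu l] then (word_resultant w)^-1 else 0].

Let zsub_neq0 s t : s != t -> z s - z t != 0.
Proof. by move=> st; rewrite subr_eq0 (inj_eq z_inj). Qed.

Lemma word_resultant_neq0 w : word_resultant w != 0.
Proof.
apply/prodf_neq0 => s _; apply/prodf_neq0 => t st; apply: zsub_neq0.
by apply: contraTneq st => ->; rewrite ltnn.
Qed.

Definition count_lt w i : nat := \sum_(l : C | (l < i)%N) cntT l w.

Lemma count_ltE w i : count_lt w i = #|[set t | (w t < i)%N]|.
Proof.
rewrite -sum1_card (partition_big w (fun l : C => (l < i)%N)) /=; last first.
  by move=> t; rewrite inE.
apply: eq_bigr => l li; rewrite sum1_card; apply: eq_card => t.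
by rewrite [RHS]unfold_in !inE /= andb_idl // => /eqP ->.
Qed.

(** Once the factors between [a] and its own colour are supplied, the right-hand side depends on the
    colour of [a] only through the sign. *)
Lemma word_resultantE w a :
  word_resultant w * \prod_(t | (w t == w a) && (t != a)) (z a - z t) =
  (\prod_(s | s != a) \prod_(t | (w s < w t)%N && (t != a)) (z s - z t)) *
  (\prod_(t | t != a) (z a - z t)) * (-1) ^+ count_lt w (w a).
Proof.
have RE : word_resultant w = (\prod_(t | (w a < w t)%N) (z a - z t)) *
   (\prod_(s | s != a) (if (w s < w a)%N then z s - z a else 1)) *
   (\prod_(s | s != a) \prod_(t | (w s < w t)%N && (t != a)) (z s - z t)).
  rewrite /word_resultant (bigD1 a) //= -mulrA; congr (_ * _).
  rewrite -big_split /=; apply: eq_bigr => s sa; case: ifP => wsa.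
    by rewrite (bigD1 a).
  rewrite mul1r; apply: eq_bigl => t; case: eqVneq => [->|_]; last by rewrite andbT.
  by rewrite wsa.
have -> : \prod_(t | t != a) (z a - z t) =
    (\prod_(t | (w t == w a) && (t != a)) (z a - z t)) *
    ((\prod_(t | (w a < w t)%N) (z a - z t)) *
     (\prod_(t | (w t < w a)%N) (z a - z t))).
  rewrite (bigID (fun t => w t == w a)) /=; congr (_ * _).
    by apply: eq_bigl => t; rewrite andbC.
  rewrite (bigID (fun t => w a < w t)%N) /=; congr (_ * _); apply: eq_bigl => t.
    case: (eqVneq t a) => [->|_] /=; first by rewrite ltnn.
    by rewrite andb_idl // => lt; apply: contraTneq lt => ->; rewrite ltnn.
  case: (eqVneq t a) => [->|_] /=; first by rewrite ltnn.
  by rewrite -leqNgt ltn_neqAle.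
rewrite {}RE.
have -> : \prod_(s | s != a) (if (w s < w a)%N then z s - z a else 1) =
   (-1) ^+ count_lt w (w a) * \prod_(t | (w t < w a)%N) (z a - z t).
  have -> : (-1) ^+ count_lt w (w a) = \prod_(t | (w t < w a)%N) (-1 : F).
    by rewrite count_ltE -prodr_const; apply: eq_bigl => t; rewrite inE.
  rewrite -big_mkcondr -big_split /=; apply: eq_big => [t|t _]; last by ring.
  by rewrite andb_idl // => lt; apply: contraTneq lt => ->; rewrite ltnn.
by ring.
Qed.

Lemma cnt_upd w a j l : (cntT l (upd w a j) + (l == w a) = cntT l w + (l == j))%N.
Proof.
have E : cnt (setT :\ a) l (upd w a j) = cnt (setT :\ a) l w.
  rewrite /cnt; apply: eq_card => t; rewrite !inE updE.
  by case: (eqVneq t a).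
rewrite !(cntD1 _ _ (in_setT a)) upd_same E [l == w a]eq_sym [l == j]eq_sym.
by rewrite -addnA addnC [(cnt _ _ _ + _)%N]addnC.
Qed.

(** The extra 1 in the exponent accounts for the moved position, which lies below colour [j] before
    the move but not after it. The sign depends only on the content of [w]. *)
Definition raise_sign w i j : F := (-1) ^+ (count_lt w i + count_lt w j).+1.

Lemma word_resultant_upd w a i j : (i < j)%N -> w a = i ->
  (word_resultant (upd w a j))^-1 = raise_sign w i j / word_resultant w *
    (\prod_(t | w t == j) (z a - z t) / \prod_(t | (w t == i) && (t != a)) (z a - z t)).
Proof.
move=> ij wa; have ji : j != i by apply: contraTneq ij => ->; rewrite ltnn.
have := word_resultantE w a; have := word_resultantE (upd w a j) a.
rewrite upd_same wa /raise_sign.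
have -> : \prod_(t | (upd w a j t == j) && (t != a)) (z a - z t) =
    \prod_(t | w t == j) (z a - z t).
  apply: eq_bigl => t; rewrite updE; case: (eqVneq t a) => [->|_]; last by rewrite andbT.
  by rewrite wa eq_sym (negPf ji) andbF.
have -> : \prod_(s | s != a) \prod_(t | (upd w a j s < upd w a j t)%N && (t != a)) (z s - z t)
    = \prod_(s | s != a) \prod_(t | (w s < w t)%N && (t != a)) (z s - z t).
  apply: eq_bigr => s sa; apply: eq_bigl => t; rewrite !updE (negPf sa).
  by case: (eqVneq t a); rewrite ?andbF.
have -> : count_lt w j = (count_lt (upd w a j) j).+1.
  rewrite !count_ltE (cardsD1 a) inE wa ij add1n; congr _.+1.
  apply: eq_card => t; rewrite !inE updE; case: (eqVneq t a) => [_|//].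
  by rewrite ltnn.
set Rup := word_resultant _; set Pj := \prod_(t | w t == j) _.
set Pi := \prod_(t | _ && _) _; set r := \prod_(s | s != a) _; set full := \prod_(t | t != a) _; set k := count_lt _ j.
move=> upE wE.
have PiN0 : Pi != 0 by apply/prodf_neq0 => t /andP[_ ta]; apply: zsub_neq0; rewrite eq_sym.
have PjN0 : Pj != 0.
  apply/prodf_neq0 => t /eqP tj; apply: zsub_neq0; apply: contraNneq ji => at_.
  by rewrite -tj -at_ wa.
have RN0 := word_resultant_neq0 w; have RupN0 : Rup != 0 by exact: word_resultant_neq0.
have restE : r * full = word_resultant w * Pi * (-1) ^+ count_lt w i.
  by rewrite wE -mulrA -expr2 sqrr_sign mulr1.
have RupE : Rup = word_resultant w * Pi * (-1) ^+ (count_lt w i + k) / Pj.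
  apply: (mulIf PjN0); rewrite upE restE exprD mulfVK //.
  by ring.
have -> : (-1) ^+ (count_lt w i + k.+1).+1 = (-1) ^+ (count_lt w i + k) :> F.
  by rewrite addnS !exprS mulrA mulrNN !mul1r.
rewrite RupE.
rewrite invf_div !invfM invr_sign.
by field; rewrite PiN0 RN0.
Qed.

(* [w] has content [mu + e_i - e_j]. *)
Definition raised mu i j w : bool :=
  [forall l, cntT l w + (l == j) == mu l + (l == i)]%N.

Lemma raised_upd mu i j w a : w a = i ->
  [forall l, cntT l (upd w a j) == mu l] = raised mu i j w.
Proof.
move=> wa; apply: eq_forallb => l.
by rewrite -(eqn_add2r (l == i)) -{1}wa cnt_upd.
Qed.

Definition colour_poly j w : {poly F} := \prod_(t | w t == j) ('X - (z t)%:P).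

Lemma colour_polyE j w :
  colour_poly j w = \prod_(x <- [seq z t | t <- enum [set t in setT | w t == j]]) ('X - x%:P).
Proof. by rewrite big_map big_enum; apply: eq_bigl => t; rewrite !inE. Qed.

Lemma size_colour_poly j w : size (colour_poly j w) = (cntT j w).+1.
Proof. by rewrite colour_polyE size_prod_XsubC size_map -cardE. Qed.

Lemma monic_colour_poly j w : colour_poly j w \is monic.
Proof. by rewrite colour_polyE monic_prod_XsubC. Qed.

(** By [word_resultant_upd] the sum over positions of colour [i] is a divided difference of
    [g * colour_poly j w]. A raised word has [mu i + 1] such positions, and the size hypothesis
    bounds the product accordingly. *)
Lemma Eop_psum mu i j (g : {poly F}) w : (i < j)%N ->
    (size g + mu j <= (mu i).+2)%N ->
  Eop i j (fun a => g.[z a]) (psum mu) w =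
    if raised mu i j w then
      raise_sign w i j / word_resultant w * (g * colour_poly j w)`_(mu i)
    else 0.
Proof.
move=> ij gmu; have ji : j != i by apply: contraTneq ij => ->; rewrite ltnn.
rewrite EopE; case: ifP => rw; last first.
  rewrite big1 // => a /eqP wa; rewrite ffunE (raised_upd _ _ wa) rw.
  by rewrite mulr0.
have cj : (cntT j w).+1 = mu j.
  by have /forallP/(_ j)/eqP := rw; rewrite eqxx (negPf ji) addn1 addn0.
have ci : cntT i w = (mu i).+1.
  by have /forallP/(_ i)/eqP := rw; rewrite eqxx eq_sym (negPf ji) addn1 addn0.
have size_gQ : (size (g * colour_poly j w)%R <= cntT i w)%N.
  apply: leq_trans (size_polyMleq _ _) _.
  by rewrite size_colour_poly cj ci -subn1 leq_subLR add1n.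
have -> : mu i = (cntT i w).-1 by rewrite ci.
rewrite -(divided_difference z_inj size_gQ) mulr_sumr.
apply: eq_big => [a|a /eqP wa]; first by rewrite !inE.
rewrite ffunE (raised_upd _ _ wa) rw (word_resultant_upd ij wa).
rewrite hornerM horner_prod !mulrA; congr (_ / _); last first.
  by apply: eq_bigl => t; rewrite !inE.
rewrite -!mulrA mulrC -!mulrA; congr (_ * (_ * _)); rewrite mulrC; congr (_ * _).
by apply: eq_bigr => t _; rewrite !hornerE.
Qed.

(** With [g = 1] the product has degree [mu j - 1], below [mu i]. *)
Lemma psum_singular mu i j : (i < j)%N -> (mu j <= mu i)%N ->
  Eop i j (ind F setT) (psum mu) = 0.
Proof.
move=> ij mij; apply/ffunP=> w; rewrite [RHS]ffunE.
rewrite (eq_Eop _ _ (v := fun a => (1 : {poly F}).[z a])); last first.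
  by move=> a; rewrite hornerC /ind inE.
rewrite Eop_psum ?size_poly1 // ?add1n ?ltnS ?(leq_trans mij) //.
case: ifP => // /forallP/(_ j)/eqP; rewrite eqxx.
have -> : (j == i) = false by apply: contraTF ij => /eqP ->; rewrite ltnn.
rewrite addn0 addn1 => cj.
by rewrite mul1r nth_default ?mulr0 // size_colour_poly cj.
Qed.

Lemma zz_horner a : zz a = ('X : {poly F}).[z a].
Proof. by rewrite hornerX /shifted /ind inE subr0 mul1r. Qed.

(** With [g = 'X] the product has degree [mu j], still below [mu i]. *)
Lemma psum_level1 mu i j : (i < j)%N -> (mu j < mu i)%N -> Eop i j zz (psum mu) = 0.
Proof.
move=> ij mij; apply/ffunP=> w; rewrite [RHS]ffunE (eq_Eop _ _ zz_horner).
rewrite Eop_psum ?size_polyX // ?add2n ?ltnS ?(ltnW mij) //.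
case: ifP => // /forallP/(_ j)/eqP; rewrite eqxx.
have -> : (j == i) = false by apply: contraTF ij => /eqP ->; rewrite ltnn.
rewrite addn0 addn1 => cj.
rewrite nth_default ?mulr0 // mulrC size_mulX ?monic_neq0 ?monic_colour_poly //.
by rewrite size_colour_poly cj.
Qed.

(* Now the divided difference is that of a monic polynomial of top degree, so
   one application gives, up to sign, the sum of content [mu + e_i - e_j]. *)
Lemma psum_level1_sq mu i j : (i < j)%N -> mu i = mu j ->
  Eop i j zz (Eop i j zz (psum mu)) = 0.
Proof.
move=> ij mij; have ji : (j == i) = false by apply: contraTF ij => /eqP ->; rewrite ltnn.
have rise w : Eop i j zz (psum mu) w =
    if raised mu i j w then raise_sign w i j / word_resultant w else 0.
  rewrite (eq_Eop _ _ zz_horner) Eop_psum ?size_polyX ?add2n ?mij //.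
  case: ifP => // /forallP/(_ j)/eqP; rewrite eqxx ji addn0 addn1 => cj.
  have := monic_colour_poly j w; rewrite monicE lead_coefE size_colour_poly cj => /eqP lc.
  by rewrite coefXM -cj /= -{2}(mulr1 (_ / _)) -lc -cj.
have [/existsP[w0 /forallP rw0]|/existsPn none] := boolP [exists w, raised mu i j w]; last first.
  suff -> : Eop i j zz (psum mu) = 0 by rewrite raddf0.
  by apply/ffunP=> w; rewrite rise (negPf (none w)) ffunE.
(* Taking the new content from a witness avoids truncated subtraction. Here [nu i = nu j + 2], so
   [psum_level1] finishes. *)
pose nu l := cntT l w0.
have raisedE w : raised mu i j w = [forall l, cntT l w == nu l].
  apply: eq_forallb => l; rewrite -(eqP (rw0 l)).
  by rewrite eqn_add2r.
have -> : Eop i j zz (psum mu) = [ffun w => raise_sign w0 i j * psum nu w].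
  apply/ffunP=> w; rewrite rise raisedE !ffunE.
  case: ifP => [/forallP cw|]; last by rewrite mulr0.
  rewrite /raise_sign /count_lt.
  by rewrite (eq_bigr nu) 1?(eq_bigr nu (fun l (_ : (l < j)%N) => eqP (cw l))) // => l _; exact/eqP.
rewrite (Eop_mult (v := zz) (D := fun=> raise_sign w0 i j)); last first.
  by move=> w a _; rewrite mulrC.
rewrite psum_level1 //; first by apply/ffunP=> w; rewrite !ffunE mulr0.
have := eqP (rw0 i); have := eqP (rw0 j).
rewrite !eqxx ji eq_sym ji mij /nu; lia.
Qed.

End PartitionSum.

(** * Uniqueness *)

Section Uniqueness.
Variables (F : numFieldType) (T : finType) (m k N : nat) (z : T -> F).
Hypothesis z_inj : injective z.
Local Notation C := 'I_m.+2.
Local Notation word := {ffun T -> C}.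
Local Notation wfun := {ffun word -> F}.
Local Notation one := (ind F [set: T]).
Local Notation zz := (shifted z [set: T] 0).
Variable lambda : C -> nat.
Hypothesis hk : (k <= m.+2)%N.
Hypothesis hlambda : forall i, lambda i = if (i < k)%N then N.+1 else N.
Implicit Types (w : word) (c : wfun).

Definition word_block c : Prop :=
  [/\ forall w, c w != 0 -> forall i, cnt setT i w = lambda i,
      forall i j : C, (i < j)%N -> Eop i j one c = 0 &
      iter (1 - (lambda ord0 - lambda ord_max)).+1 (Eop ord0 ord_max zz) c = 0].

Lemma psum_neq0 w : (forall l, cnt setT l w = lambda l) -> psum z lambda w != 0.
Proof.
move=> wl; rewrite ffunE.
have -> : [forall l, cnt setT l w == lambda l] by apply/forallP => l; rewrite wl.
by rewrite invr_neq0 // word_resultant_neq0.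
Qed.

Lemma psum_word_block : word_block (psum z lambda).
Proof.
have le_lambda (i j : C) : (i < j)%N -> (lambda j <= lambda i)%N.
  move=> ij; rewrite !hlambda; case: (ltnP j k) => [jk|_].
    by rewrite (ltn_trans ij jk).
  by case: ifP.
split=> [w|i j ij|].
- by rewrite ffunE; case: forallP => [wl _ i|_]; [exact/eqP | rewrite eqxx].
- by rewrite psum_singular ?le_lambda.
have lt01 : ((ord0 : C) < (ord_max : C))%N by [].
have := le_lambda _ _ lt01; rewrite leq_eqVlt => /orP[/eqP l01|l01].
  by rewrite l01 subnn /= psum_level1_sq.
have -> : (1 - (lambda ord0 - lambda ord_max) = 0)%N by lia.
by rewrite /= psum_level1.
Qed.

(** [swap_proportional] applies to [c] and to [psum] alike; cross-multiplying cancels the nonzero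
    [pairR] factors. *)
Lemma word_block_swap c w a b : word_block c -> w a != w b ->
    (forall l, cnt setT l w = lambda l) ->
  let v := upd (upd w a (w b)) b (w a) in
  (forall l, cnt setT l v = lambda l) /\
  c w * psum z lambda v = c v * psum z lambda w.
Proof.
wlog ab : a b / (w a < w b)%N => [hw cb wab wl v|].
  have := wab; rewrite neq_ltn => /orP[ab|ba]; first exact: hw.
  have := hw b a ba cb; rewrite eq_sym => /(_ wab wl).
  by rewrite /= -updC //; apply: contraNneq wab => ->.
move=> cb wab wl /=; have [wt sing lev] := cb.
have [wt' sing' lev'] := psum_word_block.
have nab : w a != w b by [].
split=> [l|]; first by rewrite (@cnt_swap _ _ (w a) (w b)) ?inE.
have E1 := swap_proportional hk hlambda wt sing lev z_inj ab erefl erefl wl.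
have E2 := swap_proportional hk hlambda wt' sing' lev' z_inj ab erefl erefl wl.
set v := swap _ _ _ _ _ in E1 E2; rewrite -/v.
have R1 := @pairR_neq0 _ _ _ _ z_inj _ _ nab setT w.
have R2 := @pairR_neq0 _ _ _ _ z_inj _ _ nab setT v.
apply: (mulIf R1); apply: (mulIf R2).
transitivity ((c w * pairR z (w a) (w b) setT w) *
  (psum z lambda v * pairR z (w a) (w b) setT v)); first by ring.
by rewrite E1 -E2; ring.
Qed.

(** Induction on the number of positions where the words differ: one swap corrects a position [a]
    and spoils none. *)
Lemma word_block_proportional c w w' : word_block c ->
    (forall l, cnt setT l w = lambda l) -> (forall l, cnt setT l w' = lambda l) ->
  c w * psum z lambda w' = c w' * psum z lambda w.
Proof.
move=> cb wl w'l; have [n] := ubnP #|[set t | w t != w' t]|.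
elim: n => // n IH in w wl *; rewrite ltnS => wn.
have [->//|/eqP/ffunP ww'] := eqVneq w w'.
have [a wa] : exists a, w a != w' a.
  by apply/existsP; apply: contra_notT ww' => /existsPn ww' a; exact/eqP/negPn.
(* Without such a [b], the positions of colour [w' a] in [w] would be among those in [w']; equal
   counts would make the two sets equal, which fails at [a]. *)
have [b wb w'b] : exists2 b, w b = w' a & w' b != w' a.
  have : ~~ ([set t | w t == w' a] \subset [set t | w' t == w' a]).
    apply/negP => sub.
    have : [set t | w t == w' a] == [set t | w' t == w' a].
      have cT (v : word) : #|[set t | v t == w' a]| = cnt setT (w' a) v.
        by rewrite /cnt; apply: eq_card => t; rewrite !inE.
      by rewrite eqEcard sub !cT wl w'l leqnn.
    by move=> /eqP/setP/(_ a); rewrite !inE eqxx (negPf wa).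
  by move=> /subsetPn[b]; rewrite !inE => /eqP wb w'b; exists b.
have wab : w a != w b by rewrite wb.
have [vl cv] := word_block_swap cb wab wl.
set v := upd _ _ _ in vl cv.
have ba : b != a by apply: contraNneq w'b => ->.
have {}IH : c v * psum z lambda w' = c w' * psum z lambda v.
  apply: IH => //; apply: leq_trans wn; apply: proper_card; apply/properP; split.
    apply/subsetP => t; rewrite !inE !updE.
    case: (eqVneq t b) => [->|_]; first by rewrite wb [w' a == _]eq_sym w'b.
    by case: (eqVneq t a) => [->|//]; rewrite wb eqxx.
  by exists a; rewrite !inE ?wa // !updE [a == b]eq_sym (negPf ba) eqxx wb eqxx.
apply: (mulIf (psum_neq0 vl)).
by rewrite mulrAC cv mulrAC IH; ring.
Qed.

Lemma word_block_scalar c : word_block c ->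
  exists r, c = [ffun w => r * psum z lambda w].
Proof.
move=> cb; have [wt _ _] := cb; have [wt' _ _] := psum_word_block.
have [/existsP[w0 /forallP w0l]|/existsPn none] :=
    boolP [exists w : word, forall l, cnt setT l w == lambda l].
  have {}w0l l : cnt setT l w0 = lambda l by exact/eqP.
  exists (c w0 / psum z lambda w0); apply/ffunP => w; rewrite [RHS]ffunE.
  have [/forallP wl|nwl] := boolP [forall l, cnt setT l w == lambda l].
    have {}wl l : cnt setT l w = lambda l by exact/eqP.
    rewrite mulrAC -(word_block_proportional cb wl w0l) mulfK //.
    exact: psum_neq0.
  have nz (d : wfun) : (forall w, d w != 0 -> forall i, cnt setT i w = lambda i) -> d w = 0.
    move=> wtd; apply: contraNeq nwl => /wtd wl; apply/forallP => l; exact/eqP.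
  by rewrite (nz _ wt) (nz _ wt') mulr0.
exists 0; apply/ffunP => w; rewrite ffunE mul0r.
apply: contraNeq (none w) => /wt wl; apply/forallP => l; exact/eqP.
Qed.

End Uniqueness.

(** * Polynomials and words *)

Section WordMonomials.
Variables (F : numFieldType) (m n : nat).
Local Notation word := {ffun 'I_n -> 'I_m}.
Local Notation wfun := {ffun word -> F}.
Implicit Types (p q : {mpoly F[m * n]}) (w : word) (i j : 'I_m) (a b : 'I_n).
Implicit Types (mu : 'X_{1.. m * n}) (u : 'I_n -> F).

Definition wmon w : 'X_{1.. m * n} := (\sum_a U_(mxvec_index (w a) a))%MM.

Lemma mxvec_index_eq i j a b :
  (mxvec_index i a == mxvec_index j b) = (i == j) && (a == b).
Proof.
have [g gK _] := curry_mxvec_bij m n.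
have inj : injective (uncurry (@mxvec_index m n)).
  by move=> x y /(on_can_inj gK); apply.
exact: (inj_eq inj (i, a) (j, b)).
Qed.

Lemma wmonE w i a : wmon w (mxvec_index i a) = (w a == i) :> nat.
Proof.
rewrite /wmon mnm_sumE (bigD1 a) //= mnm1E mxvec_index_eq eqxx andbT big1 ?addn0 //.
by move=> b ba; rewrite mnm1E mxvec_index_eq (negPf ba) andbF.
Qed.

Lemma mnm_index_eq mu (nu : 'X_{1.. m * n}) :
  (forall i a, mu (mxvec_index i a) = nu (mxvec_index i a)) -> mu = nu.
Proof. by move=> E; apply/mnmP => k; case/mxvec_indexP: k. Qed.

Lemma wmon_inj : injective wmon.
Proof.
move=> w w' ww'; apply/ffunP => a.
by have /eqP := wmonE w (w' a) a; rewrite ww' wmonE eqxx eq_sym eqb1 => /eqP.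
Qed.

Lemma wmon_upd w a j :
  (wmon w - U_(mxvec_index (w a) a) + U_(mxvec_index j a))%MM = wmon (upd w a j).
Proof.
apply: mnm_index_eq => i b.
rewrite mnmDE mnmBE !wmonE !mnm1E !mxvec_index_eq updE [b == a]eq_sym.
by case: (eqVneq a b) => [->|_]; rewrite ?andbT ?andbF ?subnn ?subn0 ?addn0.
Qed.

(** Degree 1 at each position selects exactly one colour there. *)
Lemma tensV_wmon p mu : p \in tensV F m n -> p@_mu != 0 -> exists w, mu = wmon w.
Proof.
rewrite -mcoeff_msupp inE => /allP pV /pV /forallP mu1.
have [w wP] : exists w : 'I_n -> 'I_m, forall a i,
    mu (mxvec_index i a) = (w a == i) :> nat.
  apply: (@fin_all_exists _ (fun=> 'I_m)
    (fun a l => forall i, mu (mxvec_index i a) = (l == i) :> nat)) => a; have /sum_nat_eq1[i [_ i1 i0]] := mu1 a.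
  exists i => j; case: eqVneq => [<-//|ij]; apply: i0 => //.
  by rewrite eq_sym.
by exists (finfun w); apply: mnm_index_eq => i a; rewrite wP wmonE ffunE.
Qed.

Definition coefs p : wfun := [ffun w : word => p@_(wmon w)].

Lemma coefs_inj p q : p \in tensV F m n -> q \in tensV F m n ->
  coefs p = coefs q -> p = q.
Proof.
move=> pV qV pq; apply/mpolyP => mu.
have [/existsP[w /eqP ->]|/existsPn none] := boolP [exists w, mu == wmon w].
  by have /ffunP/(_ w) := pq; rewrite !ffunE.
have zero r : r \in tensV F m n -> r@_mu = 0.
  move=> rV; apply: contraTeq isT => /(tensV_wmon rV)[w muw].
  by have := none w; rewrite muw eqxx.
by rewrite !zero.
Qed.

Lemma mcoeffXM (k : 'I_(m * n)) p mu :
  ('X_k * p)@_mu = if (0 < mu k)%N then p@_(mu - U_(k)) else 0.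
Proof.
rewrite mulrC; case: ifP => muk.
  have le : (U_(k) <= mu)%MM by rewrite lep1mP -lt0n.
  by rewrite -{1}(submK le) addmC mcoeffMX.
apply: memN_msupp_eq0; apply/negP; rewrite (perm_mem (msuppMX _ _)) => /mapP[nu _ E].
by move: muk; rewrite E mnmDE mnm1E eqxx.
Qed.

Lemma mcoeff_ez_op u i j p mu :
  (ez_op u i j p)@_mu = \sum_a u a *
    (if (0 < mu (mxvec_index i a))%N then
       let nu := (mu - U_(mxvec_index i a))%MM in
       p@_(nu + U_(mxvec_index j a)) *+ (nu (mxvec_index j a)).+1
     else 0).
Proof.
rewrite /ez_op raddf_sum /=; apply: eq_bigr => a _.
by rewrite mcoeffZ mcoeffXM mcoeff_deriv.
Qed.

Lemma coefs_ez_op u i j p : coefs (ez_op u i j p) = Eop i j u (coefs p).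
Proof.
apply/ffunP => w; rewrite ffunE mcoeff_ez_op EopE [RHS]big_mkcond.
apply: eq_bigr => a _; rewrite wmonE; case: eqP => [<-|_] /=; last by rewrite mulr0.
rewrite mnmBE !wmonE mnm1E mxvec_index_eq eqxx andbT subnn wmon_upd.
by rewrite mulr1n ffunE.
Qed.

Lemma e_op_ez i j p : e_op i j p = ez_op (fun=> 1) i j p.
Proof. by apply: eq_bigr => a _; rewrite scale1r. Qed.

(** A monomial of the image comes from a monomial of [p] by recolouring one position from [j] to
    [i]. *)
Lemma tensV_ez_op u i j p : p \in tensV F m n -> ez_op u i j p \in tensV F m n.
Proof.
move=> pV; rewrite inE; apply/allP => mu; rewrite mcoeff_msupp mcoeff_ez_op => nz.
have [a] : exists a, (0 < mu (mxvec_index i a))%N &&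
    (p@_(mu - U_(mxvec_index i a) + U_(mxvec_index j a)) != 0).
  apply/existsP; apply: contraNT nz => /existsPn none.
  apply/eqP; apply: big1 => a _; have := none a; rewrite negb_and.
  case: ifP => _ /=; last by rewrite mulr0.
  by rewrite negbK => /eqP ->; rewrite mul0rn mulr0.
move=> /andP[mua /(tensV_wmon pV)[w E]].
have -> : mu = wmon (upd w a i).
  have wa : w a = j.
    have := wmonE w j a; rewrite -E mnmDE mnm1E eqxx addn1.
    by case: eqP.
  rewrite -wmon_upd wa -E.
  apply: mnm_index_eq => l b; rewrite !(mnmDE, mnmBE, mnm1E) addnK.
  by rewrite subnK //; case: eqVneq => // <-.
apply/forallP => b; apply/eqP.
rewrite (eq_bigr (fun l => (upd w a i b == l : nat))) => [|l _]; last by rewrite wmonE.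
by rewrite (bigD1 (upd w a i b)) //= eqxx big1 // => l; rewrite eq_sym => /negPf ->.
Qed.

Lemma tensV_mpolyX w : 'X_[wmon w] \in tensV F m n.
Proof.
rewrite inE msuppX /= andbT; apply/forallP => b; apply/eqP.
rewrite (eq_bigr (fun l => (w b == l : nat))) => [|l _]; last by rewrite wmonE.
by rewrite (bigD1 (w b)) //= eqxx big1 // => l; rewrite eq_sym => /negPf ->.
Qed.

End WordMonomials.

(** * Ordered partitions as words, and the coefficients of [Ppoly] *)

Section PartitionPolynomial.
Variables (F : numFieldType) (m : nat) (lambda : 'I_m.+1 -> nat).
Local Notation n := (psize lambda).
Local Notation word := {ffun 'I_n -> 'I_m.+1}.
Variable z : 'I_n -> F.
Implicit Types (w : word) (I : {ffun 'I_m.+1 -> {set 'I_n}}).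

Definition parts w : {ffun 'I_m.+1 -> {set 'I_n}} := [ffun j => [set a | w a == j]].

Lemma parts_inj : injective parts.
Proof.
move=> w w' ww'; apply/ffunP => a; have /ffunP/(_ (w a)) := ww'.
by rewrite !ffunE => /setP/(_ a); rewrite !inE eqxx => /esym/eqP.
Qed.

Lemma prod_Yprod_parts w :
  \prod_j Yprod F j (parts w j) = 'X_[wmon w].
Proof.
rewrite /wmon (big_morph (fun mu => 'X_[mu] : {mpoly F[m.+1 * n]}) (@mpolyXD _ _) (@mpolyX0 _ _)).
rewrite [RHS](partition_big w xpredT) //=; apply: eq_bigr => j _.
rewrite /Yprod; apply: eq_big => [a|a]; rewrite !ffunE inE //.
by move=> /eqP <-.
Qed.

Lemma Rmulti_parts w : Rmulti z (parts w) = word_resultant z w.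
Proof.
rewrite /Rmulti /word_resultant [RHS](partition_big w xpredT) //=; apply: eq_bigr => i _.
rewrite /R2 exchange_big /=; apply: eq_big => [a|a]; rewrite ffunE inE //.
move=> /eqP wa; rewrite [RHS](partition_big w (fun j => (i < j)%N)) /=; last first.
  by move=> t; rewrite wa.
apply: eq_bigr => j ij; apply: eq_bigl => t; rewrite ffunE inE.
by rewrite andb_idl // => /eqP ->; rewrite wa.
Qed.

Lemma ordered_partition_parts w :
  ordered_partition lambda (parts w) = [forall l, cnt setT l w == lambda l].
Proof.
have E l : #|parts w l| = cnt setT l w.
  by rewrite ffunE /cnt; apply: eq_card => a; rewrite !inE.
have cover : \bigcup_(j < m.+1) parts w j == setT.
  apply/eqP/setP => a; rewrite inE; apply/bigcupP; exists (w a) => //.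
  by rewrite ffunE inE.
rewrite /ordered_partition cover andb_idl => [|_]; first by apply: eq_forallb => l; rewrite E.
apply/forallP => i; apply/forallP => j; apply/implyP => ij.
rewrite -setI_eq0; apply/eqP/setP => a; rewrite !ffunE !inE.
by case: eqP => // ->; rewrite (negPf ij).
Qed.

(** Covering gives each position a colour, and disjointness makes it unique. *)
Lemma ordered_partition_word I : ordered_partition lambda I -> exists w, I = parts w.
Proof.
move=> /and3P[/forallP disj /eqP cover _].
have [w wI] : exists w : 'I_n -> 'I_m.+1, forall a, a \in I (w a).
  apply: (@fin_all_exists _ (fun=> 'I_m.+1) (fun a l => a \in I l)) => a.
  have : a \in \bigcup_(j < m.+1) I j by rewrite cover inE.
  by move=> /bigcupP[j _ aj]; exists j.
exists (finfun w); apply/ffunP => j; apply/setP => a; rewrite !ffunE inE ffunE.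
apply/idP/eqP => [aj|<-]; last exact: wI.
apply/eqP; apply: contraTT aj => wj.
have /forallP/(_ j)/implyP/(_ wj) := disj (w a).
by rewrite disjoint_subset => /subsetP/(_ a (wI a)); rewrite inE.
Qed.

Lemma Ppoly_tensV : Ppoly lambda z \in tensV F m.+1 n.
Proof.
have [V0 VD] := tensV_submod F m.+1 n.
rewrite /Ppoly; elim/big_ind: _ => // [p q pV qV|I].
  by rewrite -[p]scale1r VD.
move=> /ordered_partition_word[w ->]; rewrite prod_Yprod_parts -[_ *: _]addr0.
by apply: VD => //; exact: tensV_mpolyX.
Qed.

(** Distinct partitions have distinct monomials, so only [parts w] contributes to the coefficient at
    [w]. *)
Lemma coefs_Ppoly : coefs (Ppoly lambda z) = psum z lambda.
Proof.
apply/ffunP => w; rewrite !ffunE raddf_sum /= -ordered_partition_parts.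
have coefE I : ordered_partition lambda I ->
   ((Rmulti z I)^-1 *: \prod_(j < m.+1) Yprod F j (I j))@_(wmon w) =
   if I == parts w then (word_resultant z w)^-1 else 0.
  move=> /ordered_partition_word[w' ->].
  rewrite mcoeffZ prod_Yprod_parts mcoeffX !(inj_eq parts_inj, inj_eq (@wmon_inj _ _)).
  by case: eqP => [->|_]; rewrite ?mulr0 // mulr1 Rmulti_parts.
rewrite (eq_bigr _ coefE) -big_mkcondr.
case: ifP => op; last first.
  rewrite big1 // => I /andP[+ /eqP IE]; by rewrite IE op.
rewrite (big_pred1 (parts w)) // => I /=; rewrite andb_idl // => /eqP ->; exact: op.
Qed.

End PartitionPolynomial.

(** * Conformal blocks at level one as blocks of words *)

Section LevelOne.
Variables (F : numFieldType) (m : nat) (lambda : 'I_m.+2 -> nat).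
Local Notation n := (psize lambda).
Local Notation word := {ffun 'I_n -> 'I_m.+2}.
Variable z : 'I_n -> F.

Local Notation coefs := (@coefs F m.+2 n).

Lemma coefs0 : coefs 0 = 0.
Proof. by apply/ffunP => w; rewrite !ffunE mcoeff0. Qed.

Lemma tensV_iter_ez_op i j r p : p \in tensV F m.+2 n ->
  iter r (ez_op z i j) p \in tensV F m.+2 n.
Proof. by move=> pV; elim: r => //= r; exact: tensV_ez_op. Qed.

Lemma coefs_iter_ez_op i j r p :
  coefs (iter r (ez_op z i j) p) = iter r (Eop i j z) (coefs p).
Proof. by elim: r => //= r <-; rewrite coefs_ez_op. Qed.

Lemma coefs_eq0 p : p \in tensV F m.+2 n -> (p == 0) = (coefs p == 0).
Proof.
have [V0 _] := tensV_submod F m.+2 n.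
move=> pV; apply/eqP/eqP => [->|p0]; first exact: coefs0.
by apply: coefs_inj => //; rewrite coefs0.
Qed.

Lemma CB_word_block p :
  reflect (p \in tensV F m.+2 n /\ word_block z lambda (coefs p)) (p \in CB lambda 1 z).
Proof.
have oneE : (fun=> 1) =1 ind F [set: 'I_n] by move=> a; rewrite /ind inE.
have zzE : z =1 shifted z [set: 'I_n] 0 by move=> a; rewrite /shifted /ind inE mul1r subr0.
have iterE r i j (c : {ffun word -> F}) :
    iter r (Eop i j z) c = iter r (Eop i j (shifted z [set: 'I_n] 0)) c.
  by elim: r => //= r ->; apply: eq_Eop.
have e_opE i j q : coefs (e_op i j q) = Eop i j (ind F [set: 'I_n]) (coefs q).
  by rewrite e_op_ez coefs_ez_op; apply: eq_Eop.
have e_opV i j q : q \in tensV F m.+2 n -> e_op i j q \in tensV F m.+2 n.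
  by rewrite e_op_ez; exact: tensV_ez_op.
(* [E_ii] multiplies by the number of letters [i]; in characteristic zero its eigenvalue determines
   that number. *)
have cartan i w q : (coefs (e_op i i q)) w = (cnt setT i w)%:R * coefs q w.
  rewrite e_opE Eop_diag -natr_sum; congr (_%:R * _); rewrite /cnt -sum1_card.
  by apply: eq_big => [a|a _]; rewrite !inE.
have [V0 VD] := tensV_submod F m.+2 n.
have [pV|npV] := boolP (p \in tensV F m.+2 n); last first.
  apply: (iffP idP) => [|[]//].
  by rewrite inE [_ \in SV _ _]inE (negPf npV).
rewrite inE [_ \in SV _ _]inE pV /=; apply: (iffP andP).
  move=> [/andP[/forallP sing /forallP wt] lev]; split=> //; split=> [w cw i|i j ij|].
  - have /eqP/(congr1 (fun q => coefs q w)) := wt i.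
    rewrite cartan [RHS]ffunE mcoeffZ; rewrite ffunE in cw *.
    by move=> /(mulIf cw)/eqP; rewrite eqr_nat => /eqP.
  - have /forallP/(_ j)/implyP/(_ ij)/eqP := sing i.
    by move=> /(congr1 coefs); rewrite e_opE coefs0.
  rewrite -iterE -coefs_iter_ez_op; apply/eqP.
  by rewrite -coefs_eq0 // tensV_iter_ez_op.
move=> [_ [wt sing lev]]; split; last first.
  rewrite -[ez_op _ _ _ _]/(iter (1 - pdiff lambda).+1 (ez_op z ord0 ord_max) p).
  by rewrite coefs_eq0 ?tensV_iter_ez_op // coefs_iter_ez_op iterE lev.
apply/andP; split.
  apply/forallP => i; apply/forallP => j; apply/implyP => ij.
  by rewrite coefs_eq0 ?e_opV // e_opE sing.
apply/forallP => i; apply/eqP; apply: coefs_inj; first exact: e_opV.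
  by rewrite -[_ *: _]addr0 VD.
apply/ffunP => w; rewrite cartan !ffunE mcoeffZ.
have [->|] := eqVneq (p@_(wmon w)) 0; first by rewrite !mulr0.
by have := wt w; rewrite ffunE => wtw /wtw ->.
Qed.

Variables (k N : nat).
Hypothesis hk : (k <= m.+2)%N.
Hypothesis hlambda : forall i, lambda i = if (i < k)%N then N.+1 else N.
Hypothesis z_inj : injective z.

Lemma Ppoly_CB : Ppoly lambda z \in CB lambda 1 z.
Proof.
apply/CB_word_block; split; first exact: Ppoly_tensV.
by rewrite coefs_Ppoly; apply: psum_word_block hlambda.
Qed.

Lemma CB_Ppoly_scalar p : p \in CB lambda 1 z -> exists r, p = r *: Ppoly lambda z.
Proof.
move=> /CB_word_block[pV /(word_block_scalar z_inj hk hlambda)[r pr]]; exists r.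
have [V0 VD] := tensV_submod F m.+2 n.
apply: coefs_inj => //; first by rewrite -[_ *: _]addr0 VD // Ppoly_tensV.
rewrite pr; apply/ffunP => w; rewrite !ffunE mcoeffZ; congr (_ * _).
by have /ffunP/(_ w) := coefs_Ppoly z; rewrite !ffunE => ->.
Qed.

(** Writing each colour [l] exactly [lambda l] times uses up all [psize lambda] positions. Such a
    word makes [Ppoly] nonzero. *)
Lemma exists_content : exists w : word, forall l, cnt setT l w = lambda l.
Proof.
pose s := flatten [seq nseq (lambda l) l | l <- enum 'I_m.+2].
have sn : size s = n.
  rewrite size_flatten /shape -map_comp sumnE big_map big_enum /=.
  by apply: eq_bigr => l _; rewrite /= size_nseq.
have [t tE] : exists t : n.-tuple 'I_m.+2, tval t = s.
  by exists (tcast sn (in_tuple s)); rewrite val_tcast.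
exists [ffun a => tnth t a] => l.
have -> : cnt setT l [ffun a => tnth t a] = count_mem l s.
  rewrite -tE -[in RHS](map_tnth_enum t) count_map.
  rewrite /cnt -sum1_card -sum1_count big_enum_cond /=.
  by apply: eq_bigl => a; rewrite !inE ffunE.
rewrite count_flatten -map_comp sumnE big_map big_enum /=.
rewrite (bigD1 l) //= count_nseq /= eqxx mul1n big1 ?addn0 // => j jl.
by rewrite count_nseq /= (negPf jl).
Qed.

Lemma Ppoly_neq0 : Ppoly lambda z != 0.
Proof.
have [w wl] := exists_content.
apply: contraNneq (psum_neq0 z_inj wl) => P0.
by rewrite -coefs_Ppoly P0 coefs0 ffunE.
Qed.

Lemma Ppoly_basis : is_basis (CB lambda 1 z) [tuple Ppoly lambda z].
Proof.
split=> [i|c|p].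
- by rewrite (tnth_nth 0) ord1 Ppoly_CB.
- rewrite big_ord1 (tnth_nth 0) /= => /eqP.
  rewrite scaler_eq0 (negPf Ppoly_neq0) orbF => /eqP c0 i.
  by rewrite ord1.
move=> /CB_Ppoly_scalar[r ->]; exists (fun=> r).
by rewrite big_ord1 (tnth_nth 0).
Qed.

End LevelOne.

Local Open Scope complex_scope.

(* The number of variables per factor, at least 2, is written m.+2. *)
Theorem theorem4p7 (R : realType) (m N k : nat) (hk : (k <= m.+2)%N)
    (lambda : 'I_m.+2 -> nat)
    (hlambda : forall i, lambda i = if (i < k)%N then N.+1 else N)
    (z : 'I_(psize lambda) -> R[i]) (hz : injective z) :
  has_dim (CB lambda 1 z) 1 /\ is_basis (CB lambda 1 z) [tuple Ppoly lambda z].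
Proof.
have basis := Ppoly_basis hk hlambda hz.
by split; first exists [tuple Ppoly lambda z].
Qed.
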